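(* Let $q\in[1,\infty)$ and let $E$ be a normed sequence space which is contained in $\ell^{q}$ and which has property $WFP(R)$ for some constant $R\ge 1$. Then $E$ is a normed $C$-interpolation space with respect to $(\ell^{1},\ell^{q})$ for some constant $C\ge 1$ if and only if it has property $S_{q}(C')$ for some possibly different constant $C'\ge 1$. More precisely: (i) If $E$ is a normed $C$-interpolation space with respect to $(\ell^{1},\ell^{q})$ for some constant $C\ge 1$, then $E$ has property $S_{q}(C)$. (ii) If $E$ has property $S_{q}(C)$ for some constant $C\ge 1$, then $E$ is a normed $C'$-interpolation space and also a normed $C'$-$K$ space with respect to $(\ell^{1},\ell^{q})$ for a certain constant $C'\ge 1$ which depends only on $R$, $C$ and $q$.
   Context: All linear spaces are over a base field which is either $\mathbb{R}$ or $\mathbb{C}$ (the result is asserted for each of the two fields). Sequences are indexed by $\mathbb{N}=\{1,2,\dots\}$. A normed sequence space $E$ is a linear space $E\neq\{0\}$ of scalar sequences equipped with a norm $\|\cdot\|_E$; it is not assumed to be complete, and set inclusions such as $E\subset \ell^q$ are not assumed to be continuous. For a bounded scalar sequence $\{x_n\}_{n\in\mathbb{N}}$, $\{x_n^*\}_{n\in\mathbb{N}}$ denotes its nonincreasing rearrangement, $x_n^*=\inf\{\lambda\ge 0 : \#\{k:|x_k|>\lambda\}\le n-1\}$. Property $S_q(C)$ (for $q\in[1,\infty)$ and $C>0$): $E$ has property $S_q(C)$ if, whenever $\{u_n\}$ and $\{v_n\}$ are two sequences in $\ell^q$ satisfying $\sum_{n=1}^N (u_n^* )^q\le\sum_{n=1}^N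 (v_n^* )^q$ for all $N\in\mathbb{N}$ and $\sum_{n=1}^\infty (u_n^* )^q=\sum_{n=1}^\infty (v_n^* )^q$, and $\{u_n\}\in E$, it follows that $\{v_n\}\in E$ and $\|\{v_n\}\|_E\le C\|\{u_n\}\|_E$. Property $WFP(R)$ (for $R>0$): for a sequence $x=\{x_n\}$ and $N\in\mathbb{N}$ let $x^{(N)}$ be the truncated sequence with $x^{(N)}_n=x_n$ for $n\le N$ and $x^{(N)}_n=0$ for $n>N$. $E$ has property $WFP(R)$ if, whenever $x$ is a sequence of non-negative numbers such that $x^{(N)}\in E$ for all $N\in\mathbb{N}$ and $\sup_N\|x^{(N)}\|_E<\infty$, it follows that $x\in E$ and $\|x\|_E\le R\sup_N\|x^{(N)}\|_E$. For a Banach couple $(A_0,A_1)$, $\mathcal{L}_1((A_0,A_1))$ denotes the set of all linear maps $T:A_0+A_1\to A_0+A_1$ such that, for $j=0,1$, $T(A_j)\subset A_j$ and $\|Ta\|_{A_j}\le\|a\|_{A_j}$ for all $a\in A_j$. A normed space $A\neq\{0\}$ contained in $A_0+A_1$ is a normed $C$-interpolation space with respect to $(A_0,A_1)$ if every $T\in\mathcal{L}_1((A_0,A_1))$ satisfies $T(A)\subset A$ and $\|Ta\|_A\le C\|a\|_A$ for all $a\in A$. The $K$-functional is $K(t,x;A_0,A_1)=\inf\{\|a_0\|_{A_0}+t\|a_1\|_{A_1}: x=a_0+a_1,\ a_j\in A_j\}$ for $x\in A_0+A_1$, $t>0$. A normed space $A\neq\{0\}$ contained in $A_0+A_1$ is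 a normed $C$-$K$ space with respect to $(A_0,A_1)$ if, whenever $x,y\in A_0+A_1$ satisfy $K(t,y;A_0,A_1)\le K(t,x;A_0,A_1)$ for all $t>0$ and $x\in A$, it follows that $y\in A$ and $\|y\|_A\le C\|x\|_A$. *)

(* Defs.v *)
From HB Require Import structures.
From mathcomp Require Import all_boot all_order all_algebra.
From mathcomp Require Import all_classical all_reals all_analysis.
From mathcomp.real_closed Require Import complex.

Set Implicit Arguments.
Unset Strict Implicit.
Unset Printing Implicit Defensive.
Import Order.TTheory GRing.Theory Num.Theory.

Local Open Scope classical_set_scope.
Local Open Scope ring_scope.

Variant base_field := RealField | ComplexField.

Definition scalar (R : realType) (F : base_field) : numFieldType :=
  match F with
  | RealField => R
  | ComplexField => R[i]
  end.

(* The norm of a [numFieldType] takes its values in the field itself; the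
   moduli, norms and sums below have to be in [R] for both fields. *)
Definition modulus (R : realType) (F : base_field) : scalar R F -> R :=
  match F return scalar R F -> R with
  | RealField => fun x : R => `|x|
  | ComplexField => fun z : R[i] => Normc.normc z
  end.

Section Modulus.
Context {R : realType} {F : base_field}.
Implicit Types a b : scalar R F.

Lemma modulus_ge0 a : 0 <= modulus a.
Proof. by case: F a => /= [x|[x y]] //=; rewrite sqrtr_ge0. Qed.

Lemma modulusM a b : modulus (a * b) = modulus a * modulus b.
Proof. by case: F a b => /= a b; [exact: normrM|exact: Normc.normcM]. Qed.

Lemma modulus0 : modulus (0 : scalar R F) = 0.
Proof. by case: F => /=; [exact: normr0|exact: Normc.normc0]. Qed.

Lemma modulus0_eq0 a : modulus a = 0 -> a = 0.
Proof. by case: F a => /= a; [exact: normr0_eq0|exact: Normc.eq0_normc]. Qed.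

Lemma le_modulusD a b : modulus (a + b) <= modulus a + modulus b.
Proof. by case: F a b => /= a b; [exact: ler_normD|exact: le_normcD]. Qed.

End Modulus.

(* A normed space whose underlying linear space is a subspace [ncarrier] of an
   ambient space [V]; the values of [nnorm] outside [ncarrier] are junk. *)
Record normed_subspace (R : realType) (F : base_field)
    (V : lmodType (scalar R F)) := NormedSubspace {
  ncarrier : set V ;
  nnorm : V -> R ;
  ncarrier0 : ncarrier 0 ;
  ncarrierD : forall x y, ncarrier x -> ncarrier y -> ncarrier (x + y) ;
  ncarrierZ : forall (a : scalar R F) x, ncarrier x -> ncarrier (a *: x) ;
  nnorm_ge0 : forall x, ncarrier x -> 0 <= nnorm x ;
  nnorm_eq0 : forall x, ncarrier x -> nnorm x = 0 -> x = 0 ;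
  nnormZ : forall (a : scalar R F) x, ncarrier x ->
    nnorm (a *: x) = modulus a * nnorm x ;
  nnormD : forall x y, ncarrier x -> ncarrier y ->
    nnorm (x + y) <= nnorm x + nnorm y
}.

Section Couples.
Context {R : realType} {F : base_field} {V : lmodType (scalar R F)}.

Definition nontrivial (A : normed_subspace V) :=
  exists2 x, ncarrier A x & x <> 0.

Definition sum_space (A0 A1 : normed_subspace V) : set V :=
  [set x | exists a0 a1, [/\ ncarrier A0 a0, ncarrier A1 a1 & x = a0 + a1]].

Definition contraction_on (A : normed_subspace V) (T : V -> V) :=
  forall a, ncarrier A a -> ncarrier A (T a) /\ nnorm A (T a) <= nnorm A a.

(* A linear map on [sum_space A0 A1] is the restriction of a map [V -> V],
   nothing being required outside [sum_space A0 A1]. *)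
Definition admissible (A0 A1 : normed_subspace V) (T : V -> V) :=
  [/\ forall x, sum_space A0 A1 x -> sum_space A0 A1 (T x),
      forall (a : scalar R F) x y, sum_space A0 A1 x -> sum_space A0 A1 y ->
        T (a *: x + y) = a *: T x + T y,
      contraction_on A0 T
    & contraction_on A1 T].

Definition interpolation_space (C : R) (A0 A1 A : normed_subspace V) :=
  [/\ nontrivial A, ncarrier A `<=` sum_space A0 A1
    & forall T, admissible A0 A1 T ->
      forall a, ncarrier A a ->
        ncarrier A (T a) /\ nnorm A (T a) <= C * nnorm A a].

Definition K_functional (t : R) (x : V) (A0 A1 : normed_subspace V) : R :=
  inf [set r | exists a0 a1, [/\ ncarrier A0 a0, ncarrier A1 a1, x = a0 + a1
                               & r = nnorm A0 a0 + t * nnorm A1 a1]].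

Definition K_space (C : R) (A0 A1 A : normed_subspace V) :=
  [/\ nontrivial A, ncarrier A `<=` sum_space A0 A1
    & forall x y, sum_space A0 A1 x -> sum_space A0 A1 y ->
      (forall t, 0 < t -> K_functional t y A0 A1 <= K_functional t x A0 A1) ->
      ncarrier A x -> ncarrier A y /\ nnorm A y <= C * nnorm A x].

End Couples.

(* Sequences are indexed from 0, so that the entry [x n] is $x_{n+1}$. *)
Definition scalar_seq (R : realType) (F : base_field) :
  lmodType (scalar R F) := (nat -> (scalar R F)^o)%type.

Section Lp.
Context {R : realType}.
Variable F : base_field.
Implicit Types (x y : scalar_seq R F) (p : R).

Definition seq_modulus x : nat -> R := fun n => modulus (x n).

Definition lp_set p : set (scalar_seq R F) :=
  [set x | finite_norm (@counting nat R) p%:E (seq_modulus x)].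

Definition lp_norm p x : R :=
  fine ('N[@counting nat R]_(p%:E)[EFin \o seq_modulus x])%E.

Lemma lp_normE p x : lp_set p x ->
  (lp_norm p x)%:E = ('N[@counting nat R]_(p%:E)[EFin \o seq_modulus x])%E.
Proof. by move=> xp; rewrite fineK// ge0_fin_numE// Lnorm_ge0. Qed.

Lemma Lnorm_seq_modulusD p x y : 1 <= p ->
  ('N[@counting nat R]_(p%:E)[EFin \o seq_modulus (x + y)] <=
   'N[@counting nat R]_(p%:E)[EFin \o seq_modulus x] +
   'N[@counting nat R]_(p%:E)[EFin \o seq_modulus y])%E.
Proof.
move=> p1; have p0 : 0 < p by rewrite (lt_le_trans ltr01).
have mf z : measurable_fun [set: nat] (seq_modulus z) by [].
have := @minkowski_EFin _ _ _ (@counting nat R) _ _ _ (mf x) (mf y) p1.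
apply: le_trans; rewrite !Lnorm_counting//.
apply: gt0_ler_poweR; rewrite ?invr_ge0 ?(ltW p0)//.
- by rewrite in_itv/= leey andbT nneseries_ge0// => n _ _; exact: poweR_ge0.
- by rewrite in_itv/= leey andbT nneseries_ge0// => n _ _; exact: poweR_ge0.
apply: lee_nneseries => [n _ _|n _]; first exact: poweR_ge0.
rewrite /= lee_fin ge0_ler_powR ?nnegrE ?(ltW p0)//.
rewrite !ger0_norm ?addr_ge0 ?modulus_ge0//.
exact: le_modulusD.
Qed.

Lemma Lnorm_seq_modulusZ p (a : scalar R F) x : 1 <= p ->
  ('N[@counting nat R]_(p%:E)[EFin \o seq_modulus (a *: x)] =
   (modulus a)%:E * 'N[@counting nat R]_(p%:E)[EFin \o seq_modulus x])%E.
Proof.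
move=> p1; have p0 : 0 < p by rewrite (lt_le_trans ltr01).
rewrite !Lnorm_counting//.
have H n : ((`|(EFin \o seq_modulus (a *: x)) n| `^ p)%E =
    (modulus a `^ p)%:E * (`|(EFin \o seq_modulus x) n| `^ p))%E.
  rewrite /= -EFinM; congr EFin.
  rewrite -powRM ?modulus_ge0// /seq_modulus [(a *: x) n]/(a * x n).
  by rewrite modulusM normrM (ger0_norm (modulus_ge0 a)).
under eq_eseriesr do rewrite H.
rewrite nneseriesZl; last by move=> n _; exact: poweR_ge0.
rewrite poweRM ?lee_fin ?powR_ge0//; last first.
  by rewrite nneseries_ge0// => n _ _; exact: poweR_ge0.
by rewrite poweR_EFin -powRrM mulfV ?gt_eqF// powRr1// modulus_ge0.
Qed.

Section NormedSpace.
Variables (p : R) (p1 : 1 <= p).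

Lemma lp_set0 : lp_set p 0.
Proof.
have -> : (0 : scalar_seq R F) = 0 *: 0 by rewrite scale0r.
by rewrite /lp_set/= /finite_norm Lnorm_seq_modulusZ// modulus0 mul0e.
Qed.

Lemma lp_setD x y : lp_set p x -> lp_set p y -> lp_set p (x + y).
Proof.
move=> xp yp; apply: le_lt_trans (Lnorm_seq_modulusD x y p1) _.
exact: lte_add_pinfty.
Qed.

Lemma lp_setZ (a : scalar R F) x : lp_set p x -> lp_set p (a *: x).
Proof.
move=> xp; rewrite /lp_set/= /finite_norm Lnorm_seq_modulusZ//.
by rewrite lte_mul_pinfty// lee_fin modulus_ge0.
Qed.

Lemma lp_norm_ge0 x : lp_set p x -> 0 <= lp_norm p x.
Proof. by move=> _; apply: fine_ge0; exact: Lnorm_ge0. Qed.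

Lemma lp_norm_eq0 x : lp_set p x -> lp_norm p x = 0 -> x = 0.
Proof.
move=> xp xp0; have := lp_normE xp; rewrite xp0 => /esym.
have p0 : 0 < p by rewrite (lt_le_trans ltr01).
rewrite Lnorm_counting// => Lx0.
apply/funext => n; apply: modulus0_eq0.
have x0 : (\sum_(0 <= k <oo) (`|(EFin \o seq_modulus x) k| `^ p) = 0)%E.
  apply: poweR_eq0_eq0 Lx0.
  by rewrite nneseries_ge0// => k _ _; exact: poweR_ge0.
have xn : ((`|(EFin \o seq_modulus x) n| `^ p)%E = 0)%E.
  apply/eqP; rewrite eq_le poweR_ge0 andbT -x0 (nneseriesD1 (n := n))//.
    rewrite leeDl// nneseries_ge0// => k _ _; exact: poweR_ge0.
  by move=> k _; exact: poweR_ge0.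
have mx0 := poweR_eq0_eq0 (abse_ge0 _) xn.
by apply: normr0_eq0; exact: EFin_inj mx0.
Qed.

Lemma lp_normZ (a : scalar R F) x : lp_set p x ->
  lp_norm p (a *: x) = modulus a * lp_norm p x.
Proof.
move=> xp; apply: EFin_inj.
by rewrite EFinM !lp_normE ?Lnorm_seq_modulusZ//; exact: lp_setZ.
Qed.

Lemma lp_normD x y : lp_set p x -> lp_set p y ->
  lp_norm p (x + y) <= lp_norm p x + lp_norm p y.
Proof.
move=> xp yp; rewrite -lee_fin EFinD !lp_normE ?Lnorm_seq_modulusD//.
exact: lp_setD.
Qed.

Definition lp_space : normed_subspace (scalar_seq R F) :=
  NormedSubspace lp_set0 lp_setD lp_setZ lp_norm_ge0 lp_norm_eq0 lp_normZ
    lp_normD.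

End NormedSpace.
End Lp.

Section SequenceSpaces.
Context {R : realType} {F : base_field}.
Implicit Types (u v x : scalar_seq R F) (E : normed_subspace (scalar_seq R F)).

(* [rearrangement x n] is $x_{n+1}^*$; for an unbounded [x] the infimum may be
   taken over the empty set, and is then the junk value 0. *)
Definition rearrangement x (n : nat) : R :=
  inf [set l | 0 <= l /\ ([set k | (l < modulus (x k))%R] #<= `I_n)%card].

(* The property $S_q(C)$. *)
Definition property_S (q C : R) E :=
  forall u v, lp_set q u -> lp_set q v ->
    (forall N, \sum_(n < N) rearrangement u n `^ q <=
               \sum_(n < N) rearrangement v n `^ q) ->
    (\sum_(0 <= n <oo) (rearrangement u n `^ q)%:E =
     \sum_(0 <= n <oo) (rearrangement v n `^ q)%:E)%E ->
    ncarrier E u -> ncarrier E v /\ nnorm E v <= C * nnorm E u.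

(* $x^{(N+1)}$: with indices starting from 0, the first [N.+1] entries are the
   [x n] with [n <= N]. *)
Definition truncation x (N : nat) : scalar_seq R F :=
  fun n => if (n <= N)%N then x n else 0.

(* The property $WFP(r)$; over the complex numbers [0 <= x n] means that [x n]
   is a non-negative real. *)
Definition property_WFP (r : R) E :=
  forall x, (forall n, 0 <= x n) ->
    (forall N, ncarrier E (truncation x N)) ->
    has_ubound (range (fun N => nnorm E (truncation x N))) ->
    ncarrier E x /\
    nnorm E x <= r * sup (range (fun N => nnorm E (truncation x N))).

End SequenceSpaces.

(* Main.v *)
(* From interpolation to S_q: if |u|^q is majorized by |v|^q, with equal totals,
   the finite Hardy-Littlewood-Polya theorem gives substochastic matrices D with
   |u|^q = D |v|^q on the first n entries of the rearrangements.  The matrices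
   D_ik v_k / u_i then define contractions of both l^1 and l^q (Jensen), and
   their coordinatewise limit along an ultrafilter maps u to v.

   From S_q to the K-property: let K(t, y) <= K(t, x) for all t, write
   Y(n) and X(n) for the sums of the n largest moduli of y and x, and take for
   y_1 the increments of the concave sequence min(Y, 2X).  Then y* <= y_1 + y_2,
   where y_1 is majorized by 2x in the l^1 sense, so that its truncations are
   averages of rearrangements of 2x and WFP applies, whereas y_2 lives where
   Y > 2X; there the K-functionals are comparable to their l^q-parts, and the
   l^q-tails of y_2 are dominated by those of 16x, to which S_q applies. *)

(* [property_S] asks for ordered partial sums and equal totals at once, and a pointwise comparison
   supplies neither. The bridge is the tail inequality of [property_S_tail]: once the missing mass
   is added to the largest entry the totals agree, and comparing tails becomes the same as comparing
   partial sums. Every use of the property on the way to the K-property goes through this form.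

   Nothing makes [E] complete or its inclusion in $\ell^q$ continuous, so [property_WFP] is the only
   limit available inside [E]. This is why the $\ell^1$-majorized piece is reached through finite
   averages of truncations, and why, in the converse direction, the limit operator must send [u] to
   [v] exactly: an image close to [v] in $\ell^q$ would say nothing about [E].

   The threshold $Y > 2X$ is what separates the two terms of the K-functional: there the head $X$
   accounts for less than half of $K(t,y)$, hence can be absorbed, and only the tail term of [x] is
   left. *)
Require Import Defs.
From HB Require Import structures.
From mathcomp Require Import all_boot all_order all_algebra.
From mathcomp Require Import all_classical all_reals all_analysis.
From mathcomp.real_closed Require Import complex.
From mathcomp Require Import ring lra zify.
Set Implicit Arguments.
Unset Strict Implicit.
Unset Printing Implicit Defensive.
Import Order.TTheory GRing.Theory Num.Theory.
Import numFieldNormedType.Exports.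
Local Open Scope classical_set_scope.
Local Open Scope ring_scope.
Local Notation scalar := Defs.scalar.

(** * Majorization of finite real sequences *)

Section RealSums.
Context {R : realType}.
Implicit Types (q : R) (f g : nat -> R).

Lemma powR_le q (s t : R) : 0 <= q -> 0 <= s -> s <= t -> s `^ q <= t `^ q.
Proof.
move=> q0 s0 st; apply: ge0_ler_powR => //; rewrite nnegrE//.
exact: le_trans st.
Qed.

Lemma powR_le_inv q (s t : R) : 0 < q -> 0 <= s -> 0 <= t ->
  s `^ q <= t `^ q -> s <= t.
Proof.
move=> q0 s0 t0; apply: contraTT; rewrite -!ltNge => ts.
by apply: gt0_ltr_powR => //; rewrite nnegrE.
Qed.

Lemma powRVK q (s : R) : 0 < q -> 0 <= s -> (s `^ q^-1) `^ q = s.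
Proof. by move=> q0 s0; rewrite -powRrM mulVf ?gt_eqF// powRr1. Qed.

Lemma powRKV q (s : R) : 0 < q -> 0 <= s -> (s `^ q) `^ q^-1 = s.
Proof. by move=> q0 s0; rewrite -powRrM mulfV ?gt_eqF// powRr1. Qed.

(** The tangent line inequality for the convex function $t^q$, obtained without derivatives from
    Young's inequality for $t$ and $s^{q-1}$ with exponents $q$ and $q/(q-1)$. *)
Lemma powR_tangent q (s t : R) : 1 <= q -> 0 <= s -> 0 <= t ->
  s `^ q + q * s `^ (q - 1) * (t - s) <= t `^ q.
Proof.
move=> q1 s0 t0; have [->|qN1] := eqVneq q 1.
  by rewrite subrr powRr0 !powRr1//; lra.
have q0 : 0 < q by lra.
have {qN1}q1' : 0 < q - 1 by rewrite subr_gt0 lt_neqAle eq_sym qN1.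
have conj1 : q^-1 + (q / (q - 1))^-1 = 1.
  by field; rewrite !gt_eqF.
have := conjugate_powR t0 (powR_ge0 s (q - 1)) q0 (divr_gt0 q0 q1') conj1.
rewrite invfM invrK -powRrM.
have -> : (q - 1) * (q / (q - 1)) = q by field; rewrite gt_eqF.
rewrite -(ler_pM2r q0) => young.
have sq : s * s `^ (q - 1) = s `^ q by rewrite mulr_powRB1.
have -> : s `^ q + q * s `^ (q - 1) * (t - s) =
    t * s `^ (q - 1) * q - (q - 1) * s `^ q.
  by rewrite -sq; ring.
rewrite lerBlDr (le_trans young)// le_eqVlt; apply/orP; left; apply/eqP.
by field; rewrite gt_eqF.
Qed.

(** Jensen's inequality for weights of total $D \le 1$: averaging the tangent lines at the mean $m$
    leaves the surplus $m^q (1-D)(q-1) \ge 0$. *)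
Lemma powR_sum_le q (I : Type) (s : seq I) (d w : I -> R) : 1 <= q ->
  (forall i, 0 <= d i) -> (forall i, 0 <= w i) -> \sum_(i <- s) d i <= 1 ->
  (\sum_(i <- s) d i * w i) `^ q <= \sum_(i <- s) d i * w i `^ q.
Proof.
move=> q1 d0 w0 d1; set m := \sum_(i <- s) d i * w i.
have m0 : 0 <= m by apply: sumr_ge0 => i _; rewrite mulr_ge0.
have : \sum_(i <- s) d i * (m `^ q + q * m `^ (q - 1) * (w i - m)) <=
    \sum_(i <- s) d i * w i `^ q.
  by apply: ler_sum => i _; rewrite ler_wpM2l// powR_tangent.
apply: le_trans.
have -> : \sum_(i <- s) d i * (m `^ q + q * m `^ (q - 1) * (w i - m)) =
    m `^ q * \sum_(i <- s) d i
    + q * m `^ (q - 1) * (m - m * \sum_(i <- s) d i).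
  rewrite /m !mulr_sumr -sumrB mulr_sumr -big_split/=.
  by apply: eq_bigr => i _; rewrite -/m; ring.
have mq : m * m `^ (q - 1) = m `^ q by rewrite mulr_powRB1//;
  apply: lt_le_trans q1.
have -> : q * m `^ (q - 1) * (m - m * \sum_(i <- s) d i) =
    q * m `^ q * (1 - \sum_(i <- s) d i) by rewrite -mq; ring.
rewrite -subr_ge0; move: d1; set D := \sum_(i <- s) d i => d1.
have -> : m `^ q * D + q * m `^ q * (1 - D) - m `^ q =
    m `^ q * ((1 - D) * (q - 1)) by ring.
by rewrite !mulr_ge0 ?powR_ge0 ?subr_ge0.
Qed.

Lemma sum_ord_cat f N M : (N <= M)%N ->
  \sum_(n < M) f n = \sum_(n < N) f n + \sum_(N <= n < M) f n.
Proof.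
move=> NM; rewrite -!(big_mkord predT f).
by rewrite (@big_cat_nat _ _ _ N 0%N M).
Qed.

Lemma sum_ord_le f N M : (forall n, 0 <= f n) -> (N <= M)%N ->
  \sum_(n < N) f n <= \sum_(n < M) f n.
Proof.
by move=> f0 NM; rewrite (sum_ord_cat f NM) lerDl sumr_ge0.
Qed.

Lemma sum_uniq_le f (s : seq nat) n : (forall k, 0 <= f k) -> uniq s ->
  {in s, forall k, (k < n)%N} -> \sum_(k <- s) f k <= \sum_(k < n) f k.
Proof.
move=> f0 us sn; rewrite -(big_mkord predT f).
rewrite [leRHS](bigID (mem s) predT)/= -[leLHS]addr0 lerD ?sumr_ge0//.
rewrite (perm_big [seq k <- index_iota 0 n | k \in s])/= ?big_filter//.
apply: uniq_perm => //; first by rewrite filter_uniq// iota_uniq.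
by move=> k; rewrite mem_filter mem_index_iota;
  case: (boolP (k \in s)) => // /sn.
Qed.

Lemma sum_inj_le f (s : nat -> nat) n : (forall k, 0 <= f k) -> injective s ->
  exists m, \sum_(k < n) f (s k) <= \sum_(k < m) f k.
Proof.
move=> f0 si; exists (\max_(k < n) s k).+1.
rewrite -(big_mkord predT (f \o s)) -(big_map s predT f).
apply: sum_uniq_le => //; first by rewrite map_inj_uniq// iota_uniq.
move=> _ /mapP[k + ->]; rewrite mem_index_iota /= => kn.
by rewrite ltnS (leq_bigmax (Ordinal kn)).
Qed.

Lemma sum_indicator n i (c : R) : (i < n)%N ->
  \sum_(k < n) c * (k == i :> nat)%:R = c.
Proof.
move=> i_n; rewrite (bigD1 (Ordinal i_n))//= eqxx mulr1 big1 ?addr0// => k ki.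
by have := negbTE ki; rewrite -val_eqE /= => ->; rewrite mulr0.
Qed.

(* The Hardy-Littlewood-Polya theorem: [b] is brought below [a] on its first
   [n] entries by finitely many transfers between two entries, each of which
   makes one more entry of [b] equal to that of [a]. *)
Lemma majorization_ind (P : (nat -> R) -> Prop) n (a : nat -> R) :
  (forall z w : nat -> R, P z -> (forall k, 0 <= w k <= z k) -> P w) ->
  (forall (z : nat -> R) i j (s : R), (i < j < n)%N -> 0 <= s <= 1 -> P z ->
    P (fun k => if k == i then (1 - s) * z i + s * z j
                else if k == j then s * z i + (1 - s) * z j else z k)) ->
  {homo a : i j / (i <= j)%N >-> j <= i} -> (forall k, 0 <= a k) ->
  forall b : nat -> R, (forall k, 0 <= b k) ->
    (forall N, (N <= n)%N -> \sum_(k < N) a k <= \sum_(k < N) b k) ->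
    P b -> P (fun k => if (k < n)%N then a k else 0).
Proof.
move=> Psolid PT a_noninc a0 b.
(* The induction runs on the number of indices below [n] at which [a] and [b] differ. *)
move: {2}(#|_|) (leqnn #|[set k : 'I_n | a k != b k]%SET|) => m.
elim: m b => [|m IH] b.
  rewrite leqn0 => /eqP/cards0_eq ab b0 _ Pb.
  apply: Psolid Pb _ => k; case: ifPn => kn; last by rewrite lexx b0.
  rewrite a0/=; have := finset.in_set0 (Ordinal kn).
  by rewrite -ab inE/= => /negbFE/eqP ->.
move=> cardab b0 ab Pb.
have [[j0 /andP[j0n bj0]]|none] := pselect (exists j, (j < n)%N && (b j < a j));
    last first.
  apply: Psolid Pb _ => k; case: ifPn => kn; last by rewrite lexx b0.
  rewrite a0/= leNgt; apply/negP => bk; apply: none; exists k.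
  by rewrite kn.
have exj : exists j, (j < n)%N && (b j < a j) by exists j0; rewrite j0n.
(* The first deficient index is taken: all entries of [b] before [j] are then at least those of [a],
   and this survives the transfer, so the partial sums up to [j] stay ordered. Later ones do not
   change. *)
case: (ex_minnP exj) => j /andP[jn bj] jmin {j0 j0n bj0 exj}.
have below k : (k < j)%N -> a k <= b k.
  move=> kj; rewrite leNgt; apply/negP => bk.
  by move: (jmin k); rewrite bk (ltn_trans kj jn) => /(_ isT);
    rewrite leqNgt kj.
have [i ij ai] : exists2 i, (i < j)%N & a i < b i.
  apply: contrapT => none; have := ab _ jn.
  rewrite !big_ord_recr/= leNgt => /negP; apply.
  rewrite ler_ltD//; apply: ler_sum => k _; rewrite leNgt.
  by apply/negP => bk; apply: none; exists k.
have aij : a j <= a i by apply: a_noninc; exact: ltnW.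
pose del : R := Num.min (b i - a i) (a j - b j).
have del0 : 0 < del by rewrite lt_min !subr_gt0 ai bj.
have del1 : del <= b i - a i by rewrite ge_min lexx.
have del2 : del <= a j - b j by rewrite ge_min lexx orbT.
have bij : 0 < b i - b j by lra.
(* The weight is at most 1 because [b j < a j <= a i < b i]; the monotonicity of [a] enters here. *)
pose s : R := del / (b i - b j).
have sdel : s * (b i - b j) = del by rewrite /s divfK// gt_eqF.
have s01 : 0 <= s <= 1.
  by rewrite /s divr_ge0 ?(ltW del0) ?(ltW bij)//= ler_pdivrMr// mul1r; lra.
have ijn : (i < j < n)%N by rewrite ij.
have := PT b i j s ijn s01 Pb; set b' := (fun k => _) => Pb'.
have ji : (j == i) = false by rewrite gtn_eqF.
have b'E k : b' k = b k - del * (k == i)%:R + del * (k == j)%:R.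
  rewrite /b'; case: (eqVneq k i) => [->|ki].
    by rewrite eq_sym ji /= -sdel; ring.
  case: (eqVneq k j) => [->|kj] /=; last by ring.
  by rewrite -sdel mulr0 mulr1 subr0; ring.
have b'i : b' i = b i - del by rewrite b'E eqxx eq_sym ji /=; ring.
have b'j : b' j = b j + del by rewrite b'E eqxx ji /=; ring.
have b'k k : k != i -> k != j -> b' k = b k.
  by rewrite b'E => /negbTE -> /negbTE ->; ring.
apply: (IH b') => //.
- have sub : ([set k : 'I_n | a k != b' k] \subset [set k : 'I_n | a k != b
    k])%SET.
    apply/fintype.subsetP => k; rewrite !inE.
    have [->|ki] := eqVneq (k : nat) i; first by rewrite (lt_eqF ai).
    have [->|kj] := eqVneq (k : nat) j; first by rewrite (gt_eqF bj).
    by rewrite b'k.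
  rewrite -ltnS (leq_trans _ cardab)//; apply: proper_card.
  rewrite fintype.properE sub /=; apply/fintype.subsetPn.
  have [le|le] := leP (b i - a i) (a j - b j).
    have delE : del = b i - a i by rewrite /del min_l.
    exists (Ordinal (ltn_trans ij jn)); rewrite inE/= ?(lt_eqF ai)//.
    by rewrite b'i delE; apply/negPn/eqP; lra.
  have delE : del = a j - b j by rewrite /del min_r// ltW.
  exists (Ordinal jn); rewrite inE/= ?(gt_eqF bj)//.
  by rewrite b'j delE; apply/negPn/eqP; lra.
- move=> k; have [->|ki] := eqVneq k i.
    by rewrite b'i; have := a0 i; lra.
  have [->|kj] := eqVneq k j; last by rewrite b'k.
  by rewrite b'j addr_ge0// ltW.
- move=> N Nn; have [Nj|jN] := leqP N j.
    apply: ler_sum => k _; have kj := leq_trans (ltn_ord k) Nj.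
    have [->|ki] := eqVneq (k : nat) i; first by rewrite b'i; lra.
    by rewrite b'k ?below// ltn_eqF.
  under [leRHS]eq_bigr do rewrite b'E.
  rewrite big_split sumrB/= !sum_indicator ?subrK ?ab//.
  exact: ltn_trans jN.
Qed.

End RealSums.

(** * Masses in l^q and decreasing rearrangements *)

(* Locked: comparing the values at two different sequences by conversion would
   unfold the whole integration theory. *)
HB.lock Definition lp_mass (R : realType) (F : base_field) (q : R)
  (x : scalar_seq R F) : R := lp_norm q x `^ q.

HB.lock Definition rearr_mass (R : realType) (F : base_field) (q : R)
  (x : scalar_seq R F) (N : nat) : R := \sum_(n < N) rearrangement x n `^ q.

Section Mass.
Context {R : realType} {F : base_field}.
Implicit Types (q : R) (x y : scalar_seq R F) (f : nat -> R) (s : nat -> nat).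

Lemma sumEFin_ord f N :
  (\sum_(0 <= n < N) (f n)%:E = (\sum_(n < N) f n)%:E)%E.
Proof. by rewrite sumEFin big_mkord. Qed.

Lemma nneseries_fin_leP f (B : R) : (forall n, 0 <= f n) ->
  (\sum_(0 <= n <oo) (f n)%:E <= B%:E)%E <->
  (forall N, \sum_(n < N) f n <= B).
Proof.
move=> f0; have ef0 n : (0 <= n)%N -> xpredT n -> (0 <= (f n)%:E)%E.
  by rewrite lee_fin.
split=> [fB N|fB].
  rewrite -lee_fin -sumEFin_ord.
  exact: le_trans (nneseries_lim_ge _ ef0) fB.
apply: lime_le; first exact: is_cvg_nneseries.
by apply: nearW => N; rewrite sumEFin_ord lee_fin.
Qed.

Lemma nneseries_fin_eqP f (B : R) : (forall n, 0 <= f n) ->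
  (forall N, \sum_(n < N) f n <= B) ->
  (forall e, 0 < e -> exists N, B - e <= \sum_(n < N) f n) ->
  (\sum_(0 <= n <oo) (f n)%:E = B%:E)%E.
Proof.
move=> f0 fB Bf; have ef0 n : (0 <= n)%N -> xpredT n -> (0 <= (f n)%:E)%E.
  by rewrite lee_fin.
have SB := (nneseries_fin_leP B f0).2 fB.
have S0 := nneseries_ge0 ef0.
have fS := fun N => nneseries_lim_ge N ef0.
move: SB S0 fS; case: (\sum_(0 <= n <oo) (f n)%:E)%E => // S.
rewrite !lee_fin => SB _ fS; congr EFin; apply/eqP; rewrite eq_le SB /=.
apply/ler_addgt0Pr => e /Bf[N]; rewrite lerBlDr => /le_trans; apply.
by rewrite lerD2r -lee_fin -sumEFin_ord.
Qed.

Lemma Lnorm_seq_modulus q x : 0 < q ->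
  ('N[@counting nat R]_(q%:E)[EFin \o seq_modulus x] =
   (\sum_(0 <= n <oo) (modulus (x n) `^ q)%:E) `^ q^-1)%E.
Proof.
move=> q0; rewrite Lnorm_counting//; congr (_ `^ _)%E.
by apply: eq_eseriesr => n _ /=; rewrite ger0_norm// modulus_ge0.
Qed.

Lemma modulusX_ge0 q x n : 0 <= modulus (x n) `^ q.
Proof. exact: powR_ge0. Qed.
Local Hint Resolve modulusX_ge0 : core.

Lemma nneseries_modulusX_ge0 q x :
  (0 <= \sum_(0 <= n <oo) (modulus (x n) `^ q)%:E)%E.
Proof. by apply: nneseries_ge0 => n _ _; rewrite lee_fin. Qed.

Lemma lp_massE q x : 0 < q -> lp_set q x ->
  (\sum_(0 <= n <oo) (modulus (x n) `^ q)%:E = (lp_mass q x)%:E)%E.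
Proof.
move=> q0; rewrite /lp_set/= /finite_norm lp_mass.unlock /lp_norm
  Lnorm_seq_modulus//.
move=> /lty_poweRy; rewrite invr_eq0 gt_eqF// => /(_ isT) Sfin.
rewrite fine_poweR powRVK ?fine_ge0 ?nneseries_modulusX_ge0//.
by rewrite fineK// ge0_fin_numE// nneseries_modulusX_ge0.
Qed.

Lemma lp_mass_ge0 q x : 0 <= lp_mass q x.
Proof. by rewrite lp_mass.unlock powR_ge0. Qed.

Lemma sum_le_lp_mass q x N : 0 < q -> lp_set q x ->
  \sum_(n < N) modulus (x n) `^ q <= lp_mass q x.
Proof.
move=> q0 xq; move: N;
  apply/(nneseries_fin_leP (lp_mass q x) (modulusX_ge0 q x)).
by rewrite lp_massE.
Qed.

Lemma lp_set_bound q x (B : R) : 0 < q ->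
  (forall N, \sum_(n < N) modulus (x n) `^ q <= B) -> lp_set q x.
Proof.
move=> q0 xB; rewrite /lp_set/= /finite_norm Lnorm_seq_modulus//.
apply: poweR_lty; rewrite (le_lt_trans _ (ltry B))//.
exact: (nneseries_fin_leP B (modulusX_ge0 q x)).2.
Qed.

Lemma lp_mass_le q x (B : R) : 0 < q ->
  (forall N, \sum_(n < N) modulus (x n) `^ q <= B) -> lp_mass q x <= B.
Proof.
move=> q0 xB; rewrite -lee_fin -lp_massE//; last exact: lp_set_bound xB.
exact: (nneseries_fin_leP B (modulusX_ge0 q x)).2.
Qed.

Lemma lp_norm_mass q x : 0 < q -> lp_norm q x = lp_mass q x `^ q^-1.
Proof. by move=> q0; rewrite lp_mass.unlock powRKV// fine_ge0// Lnorm_ge0. Qed.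

Lemma lp_norm_nneg q x : 0 <= lp_norm q x.
Proof. by rewrite fine_ge0// Lnorm_ge0. Qed.

Lemma lp_norm_le q x (c : R) : 0 < q -> 0 <= c ->
  (forall N, \sum_(n < N) modulus (x n) `^ q <= c `^ q) -> lp_norm q x <= c.
Proof.
move=> q0 c0 /(lp_mass_le q0); rewrite lp_mass.unlock; apply: powR_le_inv => //.
exact: lp_norm_nneg.
Qed.

Lemma sum_inj_le_lp_mass q x s N : 0 < q -> lp_set q x -> injective s ->
  \sum_(n < N) modulus (x (s n)) `^ q <= lp_mass q x.
Proof.
move=> q0 xq si.
have [M] := @sum_inj_le R (fun n => modulus (x n) `^ q) s N
  (modulusX_ge0 q x) si.
move=> /le_trans; apply; exact: sum_le_lp_mass.
Qed.

Lemma lp_mass_approx q x (e : R) : 0 < q -> 0 < e ->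
  exists N, lp_mass q x - e <= \sum_(n < N) modulus (x n) `^ q.
Proof.
move=> q0 e0; apply: contrapT => none.
have : lp_mass q x <= lp_mass q x - e.
  apply: lp_mass_le => // N; rewrite leNgt; apply/negP => lt.
  by apply: none; exists N; exact: ltW.
lra.
Qed.

Lemma lp_set1_sub q x : 1 <= q -> lp_set 1 x -> lp_set q x.
Proof.
move=> q1 x1; have q0 : 0 < q by lra.
pose M := lp_mass 1 x.
have xM n : modulus (x n) <= M.
  have := @sum_le_lp_mass 1 x n.+1 ltr01 x1; apply: le_trans.
  rewrite big_ord_recr/= powRr1 ?modulus_ge0// -[leLHS]add0r lerD2r.
  by rewrite sumr_ge0// => i _; exact: powR_ge0.
apply: (@lp_set_bound _ _ (M `^ (q - 1) * M)) => // N.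
rewrite (le_trans _ (ler_wpM2l _ (@sum_le_lp_mass 1 x N ltr01 x1))) ?powR_ge0//.
rewrite mulr_sumr; apply: ler_sum => n _.
rewrite powRr1 ?modulus_ge0// -(mulr_powRB1 (modulus_ge0 _) q0) mulrC.
by rewrite ler_wpM2r ?modulus_ge0// powR_le ?modulus_ge0//; lra.
Qed.

End Mass.
#[global] Hint Resolve modulus_ge0 lp_mass_ge0 : core.

(** * Sorting a null sequence in decreasing order *)

Section Sorting.
Context {R : realType}.
Implicit Types (f : nat -> R) (s : nat -> nat).

(** Only the support has to be reached, so [s] is not a permutation in general: when the support is
    infinite, a decreasing enumeration never comes to the zeros of [f]. *)
Definition sorts s f := [/\ injective s,
  {homo f \o s : i j / (i <= j)%N >-> j <= i}
  & forall k, f k != 0 -> exists n, s n = k].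

Lemma exists_max_notin f (l : seq nat) : (forall k, 0 <= f k) ->
  (forall e, 0 < e -> exists M, forall k, (M <= k)%N -> f k < e) ->
  exists2 k, k \notin l & forall j, j \notin l -> f j <= f k.
Proof.
move=> f0 fcvg; pose k0 := (\max_(k <- l) k).+1.
have k0l : k0 \notin l.
  by apply/negP => /(@leq_bigmax_seq _ _ xpredT id) /(_ isT); rewrite ltnn.
have [[j1 j1l fj1]|none] := pselect (exists2 j, j \notin l & f k0 < f j);
    last first.
  exists k0 => // j jl; rewrite leNgt; apply/negP => lt.
  by apply: none; exists j.
(* From [M] on all values are below [f j1], so the maximum is taken over finitely many indices. *)
have [M fM] := fcvg _ (le_lt_trans (f0 k0) fj1).
have j1M : (j1 < M)%N by rewrite ltnNge; apply/negP => /fM; rewrite ltxx.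
pose P := [pred j : 'I_M | val j \notin l].
have P1 : P (Ordinal j1M) by [].
have [k /= kl kmax] := @arg_maxP _ _ _ _ P (fun j : 'I_M => f j) P1.
exists (val k) => // j jl; have [jM|Mj] := ltnP j M.
  exact: (kmax (Ordinal jM)).
exact: le_trans (ltW (fM _ Mj)) (kmax _ P1).
Qed.

(** Greedy choice: [next] picks a largest entry among those not yet listed. A nonzero [f k] left out
    forever would be dominated by [f (s n)] for every [n], giving infinitely many large entries of a
    null sequence. *)
Lemma exists_sorts f : (forall k, 0 <= f k) ->
  (forall e, 0 < e -> exists M, forall k, (M <= k)%N -> f k < e) ->
  exists s, sorts s f.
Proof.
move=> f0 fcvg.
have /choice[next nextP] : forall l : seq nat, exists k, k \notin l /\
    forall j, j \notin l -> f j <= f k.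
  by move=> l; have [k] := exists_max_notin l f0 fcvg; exists k.
pose chain n := iter n (fun l => rcons l (next l)) [::].
pose s n := next (chain n).
have chainE n : chain n = map s (iota 0 n).
  by elim: n => // n IH; rewrite -[in RHS]addn1 iotaD map_cat -IH cats1.
have sij i j : (i < j)%N -> s i \in chain j.
  by move=> ij; rewrite chainE map_f// mem_iota.
have sN i j : (i <= j)%N -> s j \notin chain i.
  move=> ij; apply: contra (nextP (chain j)).1 => sji.
  suff : s j \in chain j by [].
  move: sji; rewrite !chainE => /mapP[k ki ->].
  by rewrite map_f//; move: ki; rewrite !mem_iota/= => /leq_trans; apply.
have si : injective s.
  move=> i j sE; case: (ltngtP i j) => // ij.
    by have := sN _ _ (leqnn j); rewrite -sE (sij _ _ ij).
  by have := sN _ _ (leqnn i); rewrite sE (sij _ _ ij).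
exists s; split => // [i j ij|k fk].
  by rewrite /=; apply: (nextP (chain i)).2; exact: sN.
have {}fk : 0 < f k by rewrite lt_def fk f0.
have [M fM] := fcvg _ fk.
apply: contrapT => none.
have big n : f k <= f (s n).
  apply: (nextP (chain n)).2; rewrite chainE; apply/negP => /mapP[j _ kE].
  by apply: none; exists j.
have sM n : (s n < M)%N.
  by rewrite ltnNge; apply/negP => /fM; rewrite ltNge big.
have : (size (map s (iota 0 M.+1)) <= size (iota 0 M))%N.
  apply: uniq_leq_size; first by rewrite map_inj_uniq// iota_uniq.
  by move=> _ /mapP[j _ ->]; rewrite mem_iota/= add0n.
by rewrite size_map !size_iota ltnn.
Qed.

End Sorting.

(** * Rearrangements of sequences in $\ell^q$ *)

Section Rearrangement.
Context {R : realType} {F : base_field}.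
Implicit Types (q l : R) (x y : scalar_seq R F) (s : nat -> nat).

Lemma rearrangement_le x n l s : 0 <= l ->
  (forall k, l < modulus (x k) -> exists2 m, (m < n)%N & s m = k) ->
  rearrangement x n <= l.
Proof.
move=> l0 xl; apply: ge_inf; first by exists 0 => ? [].
split=> //; apply: card_le_trans (card_image_le s `I_n).
by apply: subset_card_le => k /xl[m mn <-]; exists m.
Qed.

(** For the lower bound, a level [l] below the value at [s n] is exceeded at the [n.+1] distinct
    indices [s 0], ..., [s n], one too many for [l] to compete in the infimum. *)
Lemma rearrangement_sorts x s n : sorts s (seq_modulus x) ->
  rearrangement x n = modulus (x (s n)).
Proof.
move=> [si sx xs].
have xn k : modulus (x (s n)) < modulus (x k) -> exists2 m, (m < n)%N & s m = k.
  move=> xk.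
  have [|m sm] := xs k;
    first by rewrite gt_eqF// (le_lt_trans (modulus_ge0 _) xk).
  exists m => //; rewrite ltnNge; apply/negP => nm.
  by have := sx _ _ nm; rewrite /= sm leNgt xk.
apply/eqP; rewrite eq_le; apply/andP; split;
  first exact: (rearrangement_le _ xn).
apply: lb_le_inf.
  exists (modulus (x (s n))); split => //.
  apply: card_le_trans (card_image_le s `I_n).
  by apply: subset_card_le => k /xn[m mn <-]; exists m.
move=> l [l0 card_l]; rewrite leNgt; apply/negP => ls.
have : (`I_n.+1 #<= `I_n)%card.
  apply: card_le_trans card_l.
  have /card_eqPle[_] : (s @` `I_n.+1 #= `I_n.+1)%card.
    by apply: inj_card_eq => i j _ _; exact: si.
  move=> /card_le_trans; apply; apply: subset_card_le => _ [m /= mn <-].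
  by apply: lt_le_trans ls _; exact: sx.
by rewrite card_le_II ltnn.
Qed.

Lemma lp_set_cvg0 q x : 0 < q -> lp_set q x -> forall e, 0 < e ->
  exists M, forall k, (M <= k)%N -> modulus (x k) < e.
Proof.
move=> q0 xq e e0.
have /cvg_series_cvg_0 : cvgn (series (fun n => modulus (x n) `^ q)).
  apply: nnseries_is_cvg => [n|]; first exact: powR_ge0.
  by rewrite lp_massE// ltry.
move=> /cvgr0_norm_lt /(_ (e `^ q)); rewrite powR_gt0// => /(_ isT)[M _ xM].
exists M => k /xM /=; rewrite ger0_norm ?powR_ge0// !ltNge; apply: contra.
by move=> ek; rewrite powR_le// ltW.
Qed.

Lemma lp_set_sorts q x : 0 < q -> lp_set q x ->
  exists s, sorts s (seq_modulus x).
Proof.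
move=> q0 xq; apply: exists_sorts => [k|]; first exact: modulus_ge0.
exact: lp_set_cvg0 xq.
Qed.

(** A sorting omits only zero entries, so each finite part of the mass of [x] is reached by some
    initial segment of [s]. *)
Lemma sum_sorts_approx q x s (e : R) : 0 < q -> 0 < e ->
  sorts s (seq_modulus x) ->
  exists N, lp_mass q x - e <= \sum_(n < N) modulus (x (s n)) `^ q.
Proof.
move=> q0 e0 [si _ xs].
have [N /le_trans] := lp_mass_approx x q0 e0.
suff [M xM] : exists M, \sum_(n < N) modulus (x n) `^ q <=
    \sum_(n < M) modulus (x (s n)) `^ q by move=> /(_ _ xM); exists M.
have /choice[t tP] : forall k, exists n, modulus (x k) != 0 -> s n = k.
  move=> k; have [xk|] := boolP (modulus (x k) != 0); last by exists 0%N.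
  by have [n] := xs k xk; exists n.
pose A := [seq k <- index_iota 0 N | modulus (x k) != 0].
exists (\max_(k <- A) t k).+1.
rewrite -(big_mkord predT (fun n => modulus (x n) `^ q)).
rewrite (bigID (fun k => modulus (x k) != 0))/= [X in _ + X]big1 ?addr0;
  last first.
  by move=> k; rewrite negbK => /eqP ->; rewrite powR0// gt_eqF.
rewrite -big_filter -/A.
have -> : \sum_(k <- A) modulus (x k) `^ q =
    \sum_(n <- map t A) modulus (x (s n)) `^ q.
  rewrite big_map; apply: eq_big_seq => k; rewrite mem_filter => /andP[xk _].
  by rewrite tP.
apply: (@sum_uniq_le _ (fun n => modulus (x (s n)) `^ q)).
- by move=> k; exact: powR_ge0.
- rewrite map_inj_in_uniq ?filter_uniq ?iota_uniq// => i j.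
  rewrite !mem_filter => /andP[xi _] /andP[xj _] tij.
  by rewrite -(tP _ xi) tij tP.
- move=> _ /mapP[k kA ->]; rewrite ltnS.
  exact: (@leq_bigmax_seq _ _ xpredT t).
Qed.

Lemma rearr_mass_sorts q x s N : sorts s (seq_modulus x) ->
  rearr_mass q x N = \sum_(n < N) modulus (x (s n)) `^ q.
Proof.
move=> sx; rewrite rearr_mass.unlock; apply: eq_bigr => n _.
by rewrite (rearrangement_sorts n sx).
Qed.

Lemma rearr_mass0 q x : rearr_mass q x 0 = 0.
Proof. by rewrite rearr_mass.unlock big_ord0. Qed.

Lemma rearr_mass_cat q x N M : (N <= M)%N -> rearr_mass q x M =
  rearr_mass q x N + \sum_(N <= n < M) rearrangement x n `^ q.
Proof. by rewrite rearr_mass.unlock; exact: sum_ord_cat. Qed.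

Lemma rearr_mass_homo q x : {homo rearr_mass q x : N M / (N <= M)%N >-> N <= M}.
Proof.
rewrite rearr_mass.unlock => N M.
apply: (@sum_ord_le _ (fun n => rearrangement x n `^ q)) => n.
exact: powR_ge0.
Qed.

Lemma rearr_mass_le q x N : 0 < q -> lp_set q x ->
  rearr_mass q x N <= lp_mass q x.
Proof.
move=> q0 xq; have [s sx] := lp_set_sorts q0 xq.
by rewrite (rearr_mass_sorts _ _ sx) sum_inj_le_lp_mass//; case: sx.
Qed.

Lemma rearr_mass_approx q x (e : R) : 0 < q -> 0 < e -> lp_set q x ->
  exists N, lp_mass q x - e <= rearr_mass q x N.
Proof.
move=> q0 e0 xq; have [s sx] := lp_set_sorts q0 xq.
have [N xN] := sum_sorts_approx q0 e0 sx; exists N.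
by rewrite (rearr_mass_sorts _ _ sx).
Qed.

Lemma nneseries_rearrangement q x : 0 < q -> lp_set q x ->
  (\sum_(0 <= n <oo) (rearrangement x n `^ q)%:E = (lp_mass q x)%:E)%E.
Proof.
move=> q0 xq; apply: nneseries_fin_eqP => [n|N|e e0]; first exact: powR_ge0.
  by have := rearr_mass_le N q0 xq; rewrite rearr_mass.unlock.
by have := rearr_mass_approx q0 e0 xq; rewrite rearr_mass.unlock.
Qed.

Lemma property_S_mass q C (E : normed_subspace (scalar_seq R F)) x y : 0 < q ->
  property_S q C E -> lp_set q x -> lp_set q y ->
  (forall N, rearr_mass q x N <= rearr_mass q y N) ->
  lp_mass q x = lp_mass q y ->
  ncarrier E x -> ncarrier E y /\ nnorm E y <= C * nnorm E x.
Proof.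
move=> q0 ES xq yq xy mxy; apply: (ES x y xq yq); last first.
  by rewrite (nneseries_rearrangement q0 xq) (nneseries_rearrangement q0 yq)
    mxy.
by move: xy; rewrite rearr_mass.unlock.
Qed.

End Rearrangement.

(** * Real and imaginary parts, uniformly for both fields *)

Section Scalars.
Context {R : realType}.
Implicit Types (F : base_field) (a b : R).

Definition of_real F : R -> scalar R F :=
  match F return R -> scalar R F with
  | RealField => fun a : R => a
  | ComplexField => fun a : R => (a%:C)%C
  end.

Definition re_part F : scalar R F -> R :=
  match F return scalar R F -> R with
  | RealField => fun x : R => x
  | ComplexField => fun z : R[i] => complex.Re z
  end.

Definition im_part F : scalar R F -> R :=
  match F return scalar R F -> R with
  | RealField => fun x : R => 0
  | ComplexField => fun z : R[i] => complex.Im z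
  end.

(* Over the reals the second argument is ignored. *)
Definition of_parts F : R -> R -> scalar R F :=
  match F return R -> R -> scalar R F with
  | RealField => fun a _ : R => a
  | ComplexField => fun a b : R => (a +i* b)%C
  end.

Lemma of_real0 F : of_real F 0 = 0. Proof. by case: F. Qed.

Lemma of_real1 F : of_real F 1 = 1. Proof. by case: F. Qed.

Lemma of_realD F a b : of_real F (a + b) = of_real F a + of_real F b.
Proof. by case: F => //=; rewrite rmorphD. Qed.

Lemma of_realN F a : of_real F (- a) = - of_real F a.
Proof. by case: F => //=; rewrite rmorphN. Qed.

Lemma of_realM F a b : of_real F (a * b) = of_real F a * of_real F b.
Proof. by case: F => //=; rewrite rmorphM. Qed.

Lemma of_real_ge0 F a : 0 <= a -> 0 <= of_real F a.
Proof. by case: F => //= a0; rewrite lecR. Qed.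

Lemma modulus_of_real F a : modulus (of_real F a) = `|a|.
Proof. by case: F => //=; rewrite expr0n/= addr0 sqrtr_sqr. Qed.

Lemma modulusN F (z : scalar R F) : modulus (- z) = modulus z.
Proof. by case: F z => /= [x|[x y]]; [exact: normrN|rewrite /= !sqrrN]. Qed.

Lemma modulus1 F : modulus (1 : scalar R F) = 1.
Proof. by rewrite -of_real1 modulus_of_real normr1. Qed.

Lemma modulusV F (z : scalar R F) : modulus z^-1 = (modulus z)^-1.
Proof.
have [->|z0] := eqVneq z 0; first by rewrite invr0 modulus0 invr0.
have mz : modulus z != 0 by apply: contra_neq z0 => /modulus0_eq0.
by apply: (mulfI mz); rewrite -modulusM !divff// modulus1.
Qed.

Lemma modulus_parts F (z : scalar R F) :
  modulus z = Num.sqrt (re_part z ^+ 2 + im_part z ^+ 2).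
Proof.
by case: F z => /= [x|[x y]]//; rewrite expr0n/= addr0 sqrtr_sqr.
Qed.

Lemma parts_inj F (z w : scalar R F) :
  re_part z = re_part w -> im_part z = im_part w -> z = w.
Proof. by case: F z w => //= -[x y] [x' y'] /= -> ->. Qed.

Lemma re_of_parts F a b : re_part (of_parts F a b) = a.
Proof. by case: F. Qed.

Lemma re_partD F (z w : scalar R F) : re_part (z + w) = re_part z + re_part w.
Proof. by case: F z w => //= -[x y] [x' y']. Qed.

Lemma im_partD F (z w : scalar R F) : im_part (z + w) = im_part z + im_part w.
Proof. by case: F z w => /= [_ _|[x y] [x' y']//]; rewrite addr0. Qed.

Lemma re_partB F (z w : scalar R F) : re_part (z - w) = re_part z - re_part w.
Proof. by case: F z w => //= -[x y] [x' y']. Qed.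

Lemma im_partB F (z w : scalar R F) : im_part (z - w) = im_part z - im_part w.
Proof. by case: F z w => /= [_ _|[x y] [x' y']//]; rewrite subr0. Qed.

Lemma re_partM F (z w : scalar R F) :
  re_part (z * w) = re_part z * re_part w - im_part z * im_part w.
Proof. by case: F z w => /= [z w|[x y] [x' y']//]; rewrite mulr0 subr0. Qed.

Lemma im_partM F (z w : scalar R F) :
  im_part (z * w) = re_part z * im_part w + im_part z * re_part w.
Proof. by case: F z w => /= [z w|[x y] [x' y']//];
  rewrite mulr0 mul0r addr0. Qed.

Lemma re_part_le F (z : scalar R F) : `|re_part z| <= modulus z.
Proof.
by rewrite modulus_parts -sqrtr_sqr ler_wsqrtr// lerDl sqr_ge0.
Qed.

Lemma im_part_le F (z : scalar R F) : `|im_part z| <= modulus z.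
Proof.
by rewrite modulus_parts -sqrtr_sqr ler_wsqrtr// lerDr sqr_ge0.
Qed.

End Scalars.

Section NormedSubspace.
Context {R : realType} {F : base_field} {V : lmodType (scalar R F)}.
Implicit Types (E : normed_subspace V) (x y : V) (a b M : R).

Lemma nnorm0 E : nnorm E 0 = 0.
Proof. by rewrite -(scale0r 0) nnormZ ?modulus0 ?mul0r//; exact: ncarrier0. Qed.

Lemma nnorm_convex E x y a b M : 0 <= a -> 0 <= b -> a + b = 1 ->
  ncarrier E x /\ nnorm E x <= M -> ncarrier E y /\ nnorm E y <= M ->
  ncarrier E (of_real F a *: x + of_real F b *: y) /\
  nnorm E (of_real F a *: x + of_real F b *: y) <= M.
Proof.
move=> a0 b0 ab [Ex xM] [Ey yM].
split; first by apply: ncarrierD; exact: ncarrierZ.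
apply: le_trans (nnormD _ _) _; [exact: ncarrierZ|exact: ncarrierZ|].
rewrite !nnormZ// !modulus_of_real !ger0_norm// -[leRHS]mul1r -ab mulrDl.
by rewrite lerD// ler_wpM2l.
Qed.

End NormedSubspace.

(** * Heads and tails of rearrangements *)

Section RearrangementSums.
Context {R : realType} {F : base_field}.
Implicit Types (q : R) (x y u v : scalar_seq R F) (s : nat -> nat).

Lemma rearrangement_ge0 x n : 0 <= rearrangement x n.
Proof.
rewrite /rearrangement; set A := (X in inf X).
have [->|/set0P A0] := eqVneq A set0; first by rewrite inf0.
by apply: lb_le_inf => // l [].
Qed.

Lemma rearrangement_noninc q x : 0 < q -> lp_set q x ->
  {homo rearrangement x : i j / (i <= j)%N >-> j <= i}.
Proof.
move=> q0 xq i j ij; have [s sx] := lp_set_sorts q0 xq.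
by rewrite !(rearrangement_sorts _ sx); case: sx => _ + _; exact.
Qed.

Lemma eq_seq_modulus_rearrangement x y :
  seq_modulus x = seq_modulus y -> rearrangement x = rearrangement y.
Proof.
move=> xy; apply/funext => n; rewrite /rearrangement.
have xyE k : modulus (x k) = modulus (y k) by move/funeqP : xy => /(_ k).
by under eq_set do under eq_set do rewrite xyE.
Qed.

Lemma eq_seq_modulus_lp_set q x y :
  seq_modulus x = seq_modulus y -> lp_set q x -> lp_set q y.
Proof. by move=> xy; rewrite /lp_set/= /finite_norm xy. Qed.

Lemma eq_seq_modulus_lp_mass q x y :
  seq_modulus x = seq_modulus y -> lp_mass q x = lp_mass q y.
Proof. by move=> xy; rewrite lp_mass.unlock /lp_norm xy. Qed.

Lemma eq_seq_modulus_rearr_mass q x y :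
  seq_modulus x = seq_modulus y -> rearr_mass q x = rearr_mass q y.
Proof.
by move=> /eq_seq_modulus_rearrangement xy; rewrite rearr_mass.unlock xy.
Qed.

Lemma sum_uniq_supp_le (f : nat -> R) (l1 l2 : seq nat) :
  (forall k, 0 <= f k) -> uniq l1 -> uniq l2 ->
  (forall k, k \in l1 -> f k != 0 -> k \in l2) ->
  \sum_(k <- l1) f k <= \sum_(k <- l2) f k.
Proof.
move=> f0 u1 u2 l12; rewrite (bigID (fun k => f k != 0))/=.
rewrite [X in _ + X]big1 ?addr0 => [|k]; last by rewrite negbK => /eqP.
rewrite [leRHS](bigID (mem [seq k <- l1 | f k != 0]))/=.
rewrite -[leLHS]addr0 lerD ?sumr_ge0//.
rewrite -big_filter -[leRHS]big_filter.
rewrite (perm_big [seq k <- l2 | k \in [seq k <- l1 | f k != 0]])//.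
apply: uniq_perm; rewrite ?filter_uniq// => k.
rewrite !mem_filter; case: (boolP (f k != 0)) => //= fk.
by case: (boolP (k \in l1)) => //= kl1; rewrite l12.
Qed.

(** Threshold argument: with [c] the term of index [N] of the sorted sequence, any [N] terms sum to
    at most [N * c] plus their excesses over [c], and all excesses sit among the [N] largest
    entries, where equality holds. *)
Lemma sum_le_rearrangement q x s N : 0 < q -> lp_set q x -> injective s ->
  \sum_(n < N) modulus (x (s n)) `^ q <= rearr_mass q x N.
Proof.
move=> q0 xq si; have [t tx] := lp_set_sorts q0 xq.
rewrite (rearr_mass_sorts _ _ tx); have [ti tnoninc xt] := tx.
pose c := modulus (x (t N)) `^ q.
pose h k := Num.max (modulus (x k) `^ q - c) 0.
have h0 k : 0 <= h k by rewrite le_max lexx orbT.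
have hx k : modulus (x k) `^ q <= h k + c.
  by rewrite -lerBlDr le_max lexx.
have hxt n : (n < N)%N -> modulus (x (t n)) `^ q = h (t n) + c.
  move=> nN; rewrite /h max_l ?subrK// subr_ge0 powR_le ?(ltW q0)//.
  exact: tnoninc (ltnW nN).
apply: (@le_trans _ _ (\sum_(n < N) (h (s n) + c))).
  by apply: ler_sum.
under [leRHS]eq_bigr => n _ do rewrite hxt//.
rewrite !big_split lerD2r/=.
rewrite -(big_mkord predT (fun n => h (s n))) -(big_map s predT h).
rewrite -(big_mkord predT (fun n => h (t n))) -(big_map t predT h).
apply: sum_uniq_supp_le => //.
- by rewrite map_inj_uniq// iota_uniq.
- by rewrite map_inj_uniq// iota_uniq.
move=> k _ hk; have {}hk : c < modulus (x k) `^ q.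
  rewrite ltNge; apply: contra hk => hk.
  by rewrite /h max_r// subr_le0.
have xk : modulus (x (t N)) < modulus (x k).
  by rewrite ltNge; apply/negP => /(powR_le (ltW q0) (modulus_ge0 _));
    rewrite leNgt hk.
have [|m mk] := xt k;
  first by rewrite gt_eqF// (le_lt_trans (modulus_ge0 _) xk).
rewrite -mk map_f// mem_index_iota/= ltnNge; apply/negP => /tnoninc.
by rewrite /= mk leNgt xk.
Qed.

(** The sequence is not assumed sorted: its first [N] entries carry no more mass than its [N]
    largest ones, so cutting at an index leaves at least the mass of the sorted tail. *)
Lemma tail_mass_le q x N (B : R) : 0 < q -> lp_set q x ->
  (forall M, (N <= M)%N -> \sum_(N <= n < M) modulus (x n) `^ q <= B) ->
  lp_mass q x - rearr_mass q x N <= B.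
Proof.
move=> q0 xq xB.
have := @sum_le_rearrangement q x id N q0 xq (fun _ _ => id).
suff : lp_mass q x - \sum_(n < N) modulus (x n) `^ q <= B by rewrite /=; lra.
apply/ler_addgt0Pr => e e0; have [M xM] := lp_mass_approx x q0 e0.
have := @sum_ord_le _ _ M _ (modulusX_ge0 q x) (leq_maxr N M).
rewrite (sum_ord_cat (fun n => modulus (x n) `^ q) (leq_maxl N M)).
by have := xB _ (leq_maxl N M); lra.
Qed.

Lemma tail_mass_rearrangement_le q x N (B : R) : 0 < q -> lp_set q x ->
  (forall M, (N <= M)%N -> \sum_(N <= n < M) rearrangement x n `^ q <= B) ->
  lp_mass q x - rearr_mass q x N <= B.
Proof.
move=> q0 xq xB; apply/ler_addgt0Pr => e e0.
have [M xM] := rearr_mass_approx q0 e0 xq.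
have := rearr_mass_homo q x (leq_maxr N M).
rewrite (rearr_mass_cat q x (leq_maxl N M)).
by have := xB _ (leq_maxl N M); lra.
Qed.

Lemma tail_mass_ge q x N M : 0 < q -> lp_set q x -> (N <= M)%N ->
  \sum_(N <= n < M) rearrangement x n `^ q <=
  lp_mass q x - rearr_mass q x N.
Proof.
by move=> q0 xq NM; rewrite lerBrDl -rearr_mass_cat// rearr_mass_le.
Qed.

End RearrangementSums.

(** * Consequences of the property S_q *)

Definition real_seq (R : realType) (F : base_field) (z : nat -> R) :
  scalar_seq R F := fun n => of_real F (z n).

Section PropertyS.
Context {R : realType} {F : base_field} (q C : R)
  (E : normed_subspace (scalar_seq R F)).
Hypotheses (q1 : 1 <= q) (C1 : 1 <= C) (Eq : ncarrier E `<=` lp_set q)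
  (ES : property_S q C E).
Implicit Types (u v : scalar_seq R F).

Let q0 : 0 < q. Proof. exact: lt_le_trans q1. Qed.

Lemma modulus_real_seq (z : nat -> R) n : modulus (real_seq F z n) = `|z n|.
Proof. exact: modulus_of_real. Qed.

(* The largest entry of [v] is enlarged so that the two masses agree; [v] is a
   convex combination of the result and of its reflection in that entry. *)
Lemma property_S_tail u v : ncarrier E u -> lp_set q v ->
  (forall N, lp_mass q v - rearr_mass q v N <=
             lp_mass q u - rearr_mass q u N) ->
  ncarrier E v /\ nnorm E v <= C * nnorm E u.
Proof.
move=> Eu vq uv; have uq := Eq Eu; have [s sv] := lp_set_sorts q0 vq.
have [si snoninc vs] := sv.
pose j0 := s 0%N; pose m := modulus (v j0).
have [m0|mN0] := eqVneq m 0.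
  have -> : v = 0.
    apply/funext => k; apply: modulus0_eq0; apply/eqP; apply: contraT => vk.
    have [n nk] := vs k vk; have := snoninc 0%N n (leq0n n).
    rewrite /= nk [seq_modulus v (s 0%N)]m0 => vk0.
    by rewrite eq_le vk0/= in vk; rewrite modulus_ge0 in vk.
  split; first exact: ncarrier0.
  by rewrite nnorm0 mulr_ge0 ?nnorm_ge0// (le_trans ler01).
have m0 : 0 < m by rewrite lt_def mN0 modulus_ge0.
(* The missing mass; the hypothesis at [N = 0] gives its sign. Below, [M] is the modulus for which
   adding [D] to the mass amounts to replacing [m] by [M]. *)
pose D := lp_mass q u - lp_mass q v.
have D0 : 0 <= D by have := uv 0%N; rewrite !rearr_mass0 !subr0 subr_ge0.
pose M := (m `^ q + D) `^ q^-1.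
have mqD : 0 <= m `^ q + D by rewrite addr_ge0 ?powR_ge0.
have Mq : M `^ q = m `^ q + D by rewrite powRVK.
have mM : m <= M.
  by apply: (@powR_le_inv _ q); rewrite ?(ltW m0) ?powR_ge0// Mq lerDl.
pose c := M / m.
have c1 : 1 <= c by rewrite ler_pdivlMr// mul1r.
have cm : c * m = M by rewrite divfK.
clearbody c.
pose w (e : R) : scalar_seq R F :=
  fun k => if k == j0 then of_real F (e * c) * v k else v k.
have modw e k : `|e| = 1 ->
    modulus (w e k) = if k == j0 then M else modulus (v k).
  move=> e1; rewrite /w; case: eqP => [->|//].
  rewrite modulusM modulus_of_real normrM e1 mul1r -/m.
  by rewrite ger0_norm ?cm// (le_trans ler01).
have modwq e k : `|e| = 1 ->
    modulus (w e k) `^ q = modulus (v k) `^ q + D * (k == j0)%:R.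
  move=> e1; rewrite modw//; case: eqP => [->|_]; last by rewrite mulr0 addr0.
  by rewrite Mq mulr1.
have w1q : lp_set q (w 1).
  apply: (@lp_set_bound _ _ _ _ (lp_mass q v + D)) => // N.
  under eq_bigr => k _ do rewrite modwq ?normr1//.
  rewrite big_split/= lerD ?sum_le_lp_mass//.
  have [j0N|Nj0] := ltnP j0 N; first by rewrite sum_indicator.
  rewrite big1// => k _; rewrite (_ : (k == j0 :> nat) = false) ?mulr0//.
  by rewrite ltn_eqF// (leq_trans (ltn_ord k)).
have massw : lp_mass q (w 1) = lp_mass q u.
  apply/eqP; rewrite eq_le; apply/andP; split.
    apply: lp_mass_le => // N; under eq_bigr => k _ do rewrite modwq ?normr1//.
    rewrite big_split/= -[lp_mass q u](subrKC (lp_mass q v)) lerD//.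
      exact: sum_le_lp_mass.
    have [j0N|Nj0] := ltnP j0 N; first by rewrite sum_indicator.
    rewrite big1// => k _; rewrite (_ : (k == j0 :> nat) = false) ?mulr0//.
    by rewrite ltn_eqF// (leq_trans (ltn_ord k)).
  apply/ler_addgt0Pr => e e0; have [N vN] := lp_mass_approx v q0 e0.
  have := sum_le_lp_mass (maxn N j0.+1) q0 w1q.
  under eq_bigr => k _ do rewrite modwq ?normr1//.
  rewrite big_split/= sum_indicator ?leq_maxr// => le.
  have := sum_ord_le (modulusX_ge0 q v) (leq_maxl N j0.+1).
  by move: le; rewrite /D; lra.
(* Only an entry that was already largest has grown, so the sorting of [v] still sorts [w 1]. *)
have sw : sorts s (seq_modulus (w 1)).
  split=> // [i j ij|k].
    rewrite /= /seq_modulus !modw ?normr1//.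
    rewrite -/j0 !(inj_eq si); case: (eqVneq j 0%N) ij => [->|jN0] ij.
      by move: ij; rewrite leqn0 => ->.
    case: (eqVneq i 0%N) => [_|_]; last exact: snoninc.
    by apply: le_trans mM; exact: snoninc.
  rewrite /seq_modulus modw ?normr1//; case: (eqVneq k j0) => [-> _|_ /vs//].
  by exists 0%N.
have rw N : (0 < N)%N -> rearr_mass q (w 1) N =
    rearr_mass q v N + D.
  move=> N0; rewrite (rearr_mass_sorts _ _ sw) (rearr_mass_sorts _ _ sv).
  under eq_bigr => k _ do rewrite modwq ?normr1// (inj_eq si).
  by rewrite big_split/= sum_indicator.
(* Each partial sum over at least one term has grown by exactly [D], which turns the tail inequality
   into the one of [property_S]; the empty sum is trivial. *)
have Ew e : `|e| = 1 ->
    ncarrier E (w e) /\ nnorm E (w e) <= C * nnorm E u.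
  move=> e1; have we : seq_modulus (w 1) = seq_modulus (w e).
    by apply/funext => k; rewrite /seq_modulus !modw ?normr1.
  have weq := eq_seq_modulus_lp_set we w1q.
  apply: (property_S_mass q0 ES uq weq _ _ Eu).
    move=> N; rewrite -(eq_seq_modulus_rearr_mass _ we).
    case: N => [|N]; first by rewrite !rearr_mass0.
    by rewrite rw//; have := uv N.+1; rewrite /D; lra.
  by rewrite -(eq_seq_modulus_lp_mass _ we) massw.
have [Ew1 Ew2] := (Ew 1 (normr1 _), Ew (-1) (normrN1 _)).
have c0 : 0 < c by lra.
(* The two weights differ by [c^-1], which undoes the factor [c] in the entry [j0], and they are
   nonnegative since [c >= 1]. *)
have := nnorm_convex (a := (1 + c^-1) / 2) (b := (1 - c^-1) / 2) _ _ _ Ew1 Ew2.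
have -> : of_real F ((1 + c^-1) / 2) *: w 1 +
    of_real F ((1 - c^-1) / 2) *: w (-1) = v.
  apply/funext => k; rewrite /w !fctE /GRing.scale/=.
  case: ifP => _; rewrite ?mulrA -?of_realM -mulrDl -of_realD; last first.
    by rewrite -[RHS]mul1r -(of_real1 F); congr (of_real F _ * _); field;
       rewrite gt_eqF.
  rewrite -[RHS]mul1r -(of_real1 F); congr (of_real F _ * _).
  by field; rewrite gt_eqF.
apply.
- by rewrite divr_ge0// addr_ge0// invr_ge0 ltW.
- by rewrite divr_ge0// subr_ge0 invf_le1.
- by field; rewrite gt_eqF.
Qed.

(** Up to the factor [C], [E] is solid and rearrangement invariant: an entrywise comparison of
    rearrangements orders all their tails. *)
Lemma property_S_rearrangement u v : ncarrier E u -> lp_set q v ->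
  (forall n, rearrangement v n <= rearrangement u n) ->
  ncarrier E v /\ nnorm E v <= C * nnorm E u.
Proof.
move=> Eu vq vu; apply: property_S_tail => // N.
apply: tail_mass_rearrangement_le => // M NM.
apply: le_trans (tail_mass_ge q0 (Eq Eu) NM).
by apply: ler_sum => n _; rewrite powR_le ?(ltW q0) ?rearrangement_ge0.
Qed.

Lemma property_S_permuted u (eps : nat -> R) (p : nat -> nat) :
  ncarrier E u -> (forall n, `|eps n| <= 1) -> injective p ->
  ncarrier E (real_seq F (fun n => eps n * rearrangement u (p n))) /\
  nnorm E (real_seq F (fun n => eps n * rearrangement u (p n))) <= C * nnorm E
    u.
Proof.
move=> Eu eps1 pi; have uq := Eq Eu; set v := real_seq F _.
have vu n : modulus (v n) <= rearrangement u (p n).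
  rewrite modulus_real_seq normrM (ger0_norm (rearrangement_ge0 _ _)).
  by rewrite ler_piMl ?rearrangement_ge0.
apply: property_S_rearrangement => // [|n].
  apply: (@lp_set_bound _ _ _ _ (lp_mass q u)) => // N.
  apply: (@le_trans _ _ (\sum_(n < N) rearrangement u (p n) `^ q)).
    by apply: ler_sum => n _; rewrite powR_le ?(ltW q0).
  have [M] := @sum_inj_le R (fun n => rearrangement u n `^ q) p N
    (fun=> powR_ge0 _ _) pi.
  move=> /le_trans; apply.
  by have := rearr_mass_le M q0 uq; rewrite rearr_mass.unlock.
(* [s] inverts [p] on its range. An entry exceeding [rearrangement u n] comes from some [p k < n],
   so [s] covers all such [k] from the first [n] indices. *)
have /choice[s sp] : forall m, exists k, (exists j, p j = m) -> p k = m.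
  move=> m; have [[k pk]|none] := pselect (exists j, p j = m).
    by exists k.
  by exists 0%N => /none.
apply: (rearrangement_le (s := s)) (rearrangement_ge0 _ _) _ => k nk.
exists (p k); last by apply: pi; apply: sp; exists k.
rewrite ltnNge; apply/negP => /(rearrangement_noninc q0 uq).
by rewrite leNgt (lt_le_trans nk).
Qed.

(** The factor [C] is paid once, for the signed and permuted copies of the rearrangement of [u]. The
    transfers only form convex combinations inside a ball of [E], whereas applying [property_S]
    after each of them would make the constant grow with [N]. *)
Lemma property_S_majorized u (a w : nat -> R) N : ncarrier E u ->
  {homo a : i j / (i <= j)%N >-> j <= i} -> (forall k, 0 <= w k <= a k) ->
  (forall n, \sum_(k < n) a k <= \sum_(k < n) rearrangement u k) ->
  ncarrier E (real_seq F (fun k => if (k < N)%N then w k else 0)) /\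
  nnorm E (real_seq F (fun k => if (k < N)%N then w k else 0)) <= C * nnorm E u.
Proof.
move=> Eu a_noninc wa au.
have a0 k : 0 <= a k by have /andP[] := wa k; exact: le_trans.
(* The quantifiers over [eps] and [p] make [P] stable at no cost: lowering entries is absorbed into
   the multiplier [eps], and a transfer averages [z] with a permuted copy of itself. *)
pose P (z : nat -> R) := forall eps p, (forall n, `|eps n| <= 1) ->
  injective p -> ncarrier E (real_seq F (fun n => eps n * z (p n))) /\
  nnorm E (real_seq F (fun n => eps n * z (p n))) <= C * nnorm E u.
have Psolid z t : P z -> (forall k, 0 <= t k <= z k) -> P t.
  move=> Pz tz eps p eps1 pi.
  pose eps' n := eps n * (t (p n) / z (p n)).
  have epsE n : eps n * t (p n) = eps' n * z (p n).
    rewrite /eps'; have [z0|zN0] := eqVneq (z (p n)) 0.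
      have := tz (p n); rewrite z0 => t0.
      have -> : t (p n) = 0 by lra.
      by rewrite !mulr0.
    by rewrite -mulrA divfK.
  have -> : (fun n => eps n * t (p n)) = (fun n => eps' n * z (p n)).
    by apply/funext => n; rewrite epsE.
  apply: Pz => // n; rewrite /eps' normrM -[leRHS]mulr1 ler_pM//.
  have /andP[t0 tz'] := tz (p n); have z0 := le_trans t0 tz'.
  rewrite ger0_norm ?divr_ge0//; move: z0; rewrite le_eqVlt => /orP[/eqP <-|z0].
    by rewrite invr0 mulr0.
  by rewrite ler_pdivrMr// mul1r.
have PT (z : nat -> R) (i j : nat) (s : R) : (i < j < N)%N -> 0 <= s <= 1 ->
    P z -> P (fun k => if k == i then (1 - s) * z i + s * z j
                else if k == j then s * z i + (1 - s) * z j else z k).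
  move=> /andP[ij _] /andP[s0 s1] Pz eps p eps1 pi.
  (* The transposition of [i] and [j]: the transfer of weight [s] is $(1-s) z + s\, (z \circ t)$. *)
  pose t k := if k == i then j else if k == j then i else k.
  have ti : injective t by move=> k l; rewrite /t; do !case: eqP; lia.
  have := nnorm_convex (a := 1 - s) (b := s) _ _ _
    (Pz _ _ eps1 pi) (Pz _ _ eps1 (inj_comp ti pi)).
  set lhs := (_ *: _ + _ *: _ : scalar_seq R F).
  have -> : lhs = real_seq F (fun n => eps n *
      (if p n == i then (1 - s) * z i + s * z j
       else if p n == j then s * z i + (1 - s) * z j else z (p n))).
    apply/funext => n; rewrite /lhs !fctE /GRing.scale/= /real_seq.
    rewrite -!of_realM -of_realD; congr of_real; rewrite /= /t.
    case: (eqVneq (p n) i) => [->|_]; first by ring.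
    by case: (eqVneq (p n) j) => [->|_]; ring.
  by apply; rewrite ?subr_ge0// subrK.
have Pu : P (rearrangement u) by move=> eps p; exact: property_S_permuted.
have Pa := majorization_ind Psolid PT a_noninc a0
  (rearrangement_ge0 u) (fun n _ => au n) Pu.
have wa' k : 0 <= (if (k < N)%N then w k else 0) <=
  (if (k < N)%N then a k else 0) by case: ifP => _; rewrite ?wa ?lexx.
have one (n : nat) : `|(1 : R)| <= 1 by rewrite normr1.
have := Psolid _ _ Pa wa' (fun=> 1) id one (fun _ _ => id).
by under eq_fun do rewrite mul1r.
Qed.

Lemma property_S_WFP_majorized r u (a w : nat -> R) : 0 <= r ->
  property_WFP r E -> ncarrier E u ->
  {homo a : i j / (i <= j)%N >-> j <= i} -> (forall k, 0 <= w k <= a k) ->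
  (forall n, \sum_(k < n) a k <= \sum_(k < n) rearrangement u k) ->
  ncarrier E (real_seq F w) /\ nnorm E (real_seq F w) <= r * (C * nnorm E u).
Proof.
move=> r0 EW Eu a_noninc wa au.
(* [truncation _ N] keeps the indices up to and including [N], hence [N.+1] entries. *)
have trE N : truncation (real_seq F w) N =
    real_seq F (fun k => if (k < N.+1)%N then w k else 0).
  apply/funext => k; rewrite /truncation /real_seq ltnS.
  by case: ifP => // _; rewrite of_real0.
have trP N := property_S_majorized N.+1 Eu a_noninc wa au.
have ub : ubound (range (fun N => nnorm E (truncation (real_seq F w) N)))
    (C * nnorm E u) by move=> _ [N _ <-]; rewrite trE; case: (trP N).
have [| | |Ew wr] := EW (real_seq F w).
- by move=> n; rewrite of_real_ge0//; case/andP: (wa n).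
- by move=> N; rewrite trE; case: (trP N).
- by exists (C * nnorm E u).
split=> //; apply: le_trans wr _; rewrite ler_wpM2l//.
apply: ge_sup => //.
by exists (nnorm E (truncation (real_seq F w) 0%N)); exists 0%N.
Qed.

End PropertyS.

(** * The K-functional of (l^1, l^q) *)

Section KFunctional.
Context {R : realType} {F : base_field} (q : R).
Hypothesis q1 : 1 <= q.
Implicit Types (x y a b : scalar_seq R F) (s : nat -> nat) (t : R).

Let q0 : 0 < q. Proof. exact: lt_le_trans q1. Qed.

Local Notation K t x := (K_functional t x (lp_space F (lexx 1)) (lp_space F
  q1)).

Lemma sum_uniq_le_lp_mass x (l : seq nat) : lp_set q x -> uniq l ->
  \sum_(k <- l) modulus (x k) `^ q <= lp_mass q x.
Proof.
move=> xq ul; apply: le_trans (sum_le_lp_mass (\max_(k <- l) k).+1 q0 xq).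
apply: (sum_uniq_le (f := fun k => modulus (x k) `^ q)) => //.
  by move=> k; exact: powR_ge0.
by move=> k kl; rewrite ltnS; exact: (@leq_bigmax_seq _ _ xpredT id).
Qed.

Lemma sum_inj_le_lp_norm1 a s N : lp_set 1 a -> injective s ->
  \sum_(n < N) modulus (a (s n)) <= lp_norm 1 a.
Proof.
move=> a1 si; rewrite lp_norm_mass// invr1 powRr1//.
apply: le_trans (sum_inj_le_lp_mass N ltr01 a1 si).
by apply: ler_sum => n _; rewrite powRr1.
Qed.

Lemma K_functional_le t x a b : 0 < t -> lp_set 1 a -> lp_set q b ->
  x = a + b -> K t x <= lp_norm 1 a + t * lp_norm q b.
Proof.
move=> t0 a1 bq xab; apply: ge_inf; last by exists a, b.
exists 0 => _ [a' [b' [_ _ _ ->]]] /=.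
by rewrite addr_ge0 ?mulr_ge0 ?lp_norm_nneg ?(ltW t0).
Qed.

(** Membership in the sum space guards against the infimum of the empty set, which is 0 by
    convention. *)
Lemma K_functional_ge t x (c : R) :
  sum_space (lp_space F (lexx 1)) (lp_space F q1) x ->
  (forall a b, lp_set 1 a -> lp_set q b -> x = a + b ->
    c <= lp_norm 1 a + t * lp_norm q b) -> c <= K t x.
Proof.
move=> [a [b [a1 bq xab]]] cx; apply: lb_le_inf.
  by exists (lp_norm 1 a + t * lp_norm q b), a, b.
by move=> _ [a' [b' [a1' bq' xab' ->]]]; exact: cx.
Qed.

Lemma sum_space_lp x :
  sum_space (lp_space F (lexx 1)) (lp_space F q1) x -> lp_set q x.
Proof.
by move=> [a [b [a1 bq ->]]]; apply: lp_setD => //; exact: lp_set1_sub a1.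
Qed.

(** The splitting puts the [N] largest entries into $\ell^1$ and the others into $\ell^q$. *)
Lemma K_functional_le_sorted t x s N : 0 < t -> lp_set q x ->
  sorts s (seq_modulus x) ->
  K t x <= \sum_(n < N) rearrangement x n +
           t * (lp_mass q x - rearr_mass q x N) `^ q^-1.
Proof.
move=> t0 xq sx; have [si _ _] := sx.
pose A := map s (index_iota 0 N).
have uA : uniq A by rewrite map_inj_uniq// iota_uniq.
pose a : scalar_seq R F := fun k => if k \in A then x k else 0.
pose b : scalar_seq R F := fun k => if k \in A then 0 else x k.
have xab : x = a + b.
  apply/funext => k; rewrite fctE /a /b.
  by case: ifP => _; rewrite ?addr0 ?add0r.
have sumA (p : R) : \sum_(k <- A) modulus (x k) `^ p =
    \sum_(n < N) modulus (x (s n)) `^ p.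
  by rewrite big_map big_mkord.
have X1 : \sum_(n < N) rearrangement x n = \sum_(k <- A) modulus (x k) `^ 1.
  rewrite sumA; apply: eq_bigr => n _.
  by rewrite powRr1 ?modulus_ge0// (rearrangement_sorts _ sx).
have aX M : \sum_(k < M) modulus (a k) `^ 1 <= \sum_(n < N) rearrangement x n.
  rewrite X1 -(big_mkord predT (fun k => modulus (a k) `^ 1)).
  rewrite (_ : \sum_(k <- A) _ = \sum_(k <- A) modulus (a k) `^ 1); last first.
    by apply: eq_big_seq => k kA; rewrite /a kA.
  apply: (sum_uniq_supp_le (f := fun k => modulus (a k) `^ 1)) => //.
  - by move=> k; exact: powR_ge0.
  - exact: iota_uniq.
  - move=> k _; rewrite /a; case: ifP => // _.
    by rewrite modulus0 powR0 ?oner_eq0// eqxx.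
have X0 : 0 <= \sum_(n < N) rearrangement x n.
  by apply: sumr_ge0 => n _; exact: rearrangement_ge0.
have bT M : \sum_(k < M) modulus (b k) `^ q <= lp_mass q x - rearr_mass q x N.
  rewrite lerBrDr (rearr_mass_sorts _ _ sx) -sumA.
  rewrite -(big_mkord predT (fun k => modulus (b k) `^ q)).
  rewrite (bigID (fun k => k \in A))/= big1 ?add0r; last first.
    by move=> k kA; rewrite /b kA modulus0 powR0// gt_eqF.
  rewrite (_ : \sum_(0 <= k < M | _) _ =
      \sum_(k <- [seq k <- iota 0 M | k \notin A]) modulus (x k) `^ q);
        last first.
    rewrite big_filter /index_iota subn0.
    by apply: eq_bigr => k kA; rewrite /b (negbTE kA).
  rewrite -big_cat; apply: sum_uniq_le_lp_mass => //.
  rewrite cat_uniq uA filter_uniq ?iota_uniq// andbT /=.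
  by apply/hasPn => k kA; rewrite mem_filter kA.
have T0 : 0 <= lp_mass q x - rearr_mass q x N.
  by apply: le_trans (bT 0%N); rewrite big_ord0.
apply: le_trans (K_functional_le t0 _ _ xab) _.
- exact: lp_set_bound ltr01 aX.
- exact: lp_set_bound q0 bT.
apply: lerD; first by apply: lp_norm_le => // M; rewrite [leRHS]powRr1.
rewrite ler_wpM2l ?(ltW t0)//; apply: lp_norm_le => // [|M].
  exact: powR_ge0.
by rewrite powRVK.
Qed.

(** The norm of the identity from $\ell^q$ to $\ell^1$ in dimension $N$. At this value of $t$,
    cutting after the $N$ largest entries is optimal for the K-functional up to a constant, as in
    Holmstedt's formula. *)
Definition scale_at (N : nat) : R := N%:R `^ (1 - q^-1).

Lemma scale_at_gt0 N : (0 < N)%N -> 0 < scale_at N.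
Proof. by move=> N0; rewrite powR_gt0// ltr0n. Qed.

Lemma scale_at_powR N : scale_at N `^ q = N%:R `^ (q - 1).
Proof. by rewrite -powRrM mulrBl mul1r mulVf// gt_eqF. Qed.

Lemma scale_at_le N : (0 < N)%N -> scale_at N <= N%:R.
Proof.
move=> N0; rewrite /scale_at -[leRHS]powRr1// ler_powR ?ler1n//.
by rewrite gerBl invr_ge0 ltW.
Qed.

(** Hölder's inequality for [N] terms, read off from Jensen's with the equal weights $1/N$. *)
Lemma sum_le_scale_at (w : nat -> R) (c : R) N : (0 < N)%N -> 0 <= c ->
  (forall n, 0 <= w n) -> \sum_(n < N) w n `^ q <= c `^ q ->
  \sum_(n < N) w n <= scale_at N * c.
Proof.
move=> N0 c0 w0 wc; have N0' : 0 < N%:R :> R by rewrite ltr0n.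
have := @powR_sum_le R q _ (index_enum 'I_N) (fun=> N%:R^-1)
  (fun n : 'I_N => w n) q1.
rewrite sumr_const card_ord -[X in X <= 1]mulr_natl mulfV ?gt_eqF// lexx.
rewrite -!mulr_sumr invr_ge0 ler0n => /(_ (fun=> isT) (fun n => w0 n) isT).
set S := \sum_(n < N) w n => jensen.
have S0 : 0 <= S by apply: sumr_ge0.
apply: (powR_le_inv q0) => //; first by rewrite mulr_ge0// powR_ge0.
rewrite (powRM _ (powR_ge0 _ _) c0) scale_at_powR.
have -> : S = N%:R * (N%:R^-1 * S) by rewrite mulrA mulfV ?mul1r// gt_eqF.
rewrite powRM ?mulr_ge0 ?invr_ge0 ?ler0n//.
rewrite -(mulr_powRB1 (ler0n _ N) q0) mulrC mulrA mulrC.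
rewrite ler_wpM2l ?powR_ge0//.
apply: le_trans (ler_wpM2r (ler0n _ N) jensen) _.
by rewrite mulrC mulrA mulfV ?mul1r// gt_eqF.
Qed.

Lemma sum_rearrangement_le_split y a b N : (0 < N)%N ->
  lp_set 1 a -> lp_set q b -> y = a + b ->
  \sum_(n < N) rearrangement y n <= lp_norm 1 a + scale_at N * lp_norm q b.
Proof.
move=> N0 a1 bq yab; have yq : lp_set q y.
  by apply: sum_space_lp; exists a, b.
have [s sy] := lp_set_sorts q0 yq; have [si _ _] := sy.
apply: (@le_trans _ _ (\sum_(n < N) (modulus (a (s n)) + modulus (b (s n))))).
  apply: ler_sum => n _; rewrite (rearrangement_sorts _ sy) yab.
  exact: le_modulusD.
rewrite big_split lerD//=.
  exact: sum_inj_le_lp_norm1.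
apply: (sum_le_scale_at (w := fun n => modulus (b (s n)))) => //;
  first exact: lp_norm_nneg.
by rewrite lp_norm_mass// powRVK// sum_inj_le_lp_mass.
Qed.

(** Let $k$ be the cost of the splitting. Past the [N] largest entries $|y|$ is at most their
    average, hence at most $k/N$. Where $|a|$ dominates, $|y|^q \le (k/N)^{q-1}\, 2|a|$, which is
    summable through the $\ell^1$-norm of [a]; elsewhere $|y|^q \le 2^q |b|^q$. The factor $N^{q-1}$
    on the left cancels the denominator, and $2 + 2^q \le 4^q$ yields the constant. *)
Lemma tail_mass_le_split y a b N : (0 < N)%N ->
  lp_set 1 a -> lp_set q b -> y = a + b ->
  scale_at N `^ q * (lp_mass q y - rearr_mass q y N) <=
  (4 * (lp_norm 1 a + scale_at N * lp_norm q b)) `^ q.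
Proof.
move=> N0 a1 bq yab; have yq : lp_set q y.
  by apply: sum_space_lp; exists a, b.
have [s sy] := lp_set_sorts q0 yq; have [si sy_noninc _] := sy.
have t0 := scale_at_gt0 N0; have N0' : 0 < N%:R :> R by rewrite ltr0n.
set k := lp_norm 1 a + _.
have a_ge0 := lp_norm_nneg 1 a; have b_ge0 := lp_norm_nneg q b.
have tb0 : 0 <= scale_at N * lp_norm q b by rewrite mulr_ge0// ltW.
have k0 : 0 <= k by rewrite addr_ge0.
have yN n : (N <= n)%N -> modulus (y (s n)) <= k / N%:R.
  move=> Nn; rewrite ler_pdivlMr//.
  apply: le_trans (sum_rearrangement_le_split N0 a1 bq yab).
  rewrite mulr_natr -[X in _ *+ X](card_ord N) -sumr_const.
  apply: ler_sum => i _; rewrite (rearrangement_sorts _ sy).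
  by apply: sy_noninc; rewrite (leq_trans (ltnW (ltn_ord i))).
have qB : 0 <= q - 1 by rewrite subr_ge0.
pose L := (k / N%:R) `^ (q - 1) * 2.
have L0 : 0 <= L by rewrite mulr_ge0// powR_ge0.
have yn n : (N <= n)%N -> modulus (y (s n)) `^ q <=
    L * modulus (a (s n)) + 2 `^ q * modulus (b (s n)) `^ q.
  move=> /yN; have := le_modulusD (a (s n)) (b (s n)).
  rewrite -[X in modulus X]/((a + b) (s n)) -yab => yab' yk.
  have [ba|ab] := leP (modulus (b (s n))) (modulus (a (s n))).
    rewrite -[leLHS]addr0 lerD ?mulr_ge0 ?powR_ge0//.
    rewrite -(mulr_powRB1 (modulus_ge0 _) q0) mulrC /L -mulrA.
    by rewrite ler_pM ?powR_ge0 ?modulus_ge0 ?powR_le ?modulus_ge0//; lra.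
  rewrite -[leLHS]add0r lerD ?(mulr_ge0 L0 (modulus_ge0 _))//.
  rewrite -powRM ?modulus_ge0// powR_le ?modulus_ge0 ?(ltW q0)//.
  by lra.
have tail : lp_mass q y - rearr_mass q y N <=
    L * lp_norm 1 a + 2 `^ q * lp_norm q b `^ q.
  apply: tail_mass_rearrangement_le => // M NM.
  apply: (@le_trans _ _ (\sum_(N <= n < M)
      (L * modulus (a (s n)) + 2 `^ q * modulus (b (s n)) `^ q))).
    rewrite big_nat [leRHS]big_nat; apply: ler_sum => n /andP[Nn _].
    by rewrite (rearrangement_sorts _ sy) yn.
  rewrite big_split -!mulr_sumr lerD//=.
    rewrite ler_wpM2l//.
    apply: le_trans (sum_inj_le_lp_norm1 M a1 si).
    rewrite (sum_ord_cat (fun n => modulus (a (s n))) NM) lerDr.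
    by rewrite sumr_ge0// => n _; exact: modulus_ge0.
  rewrite ler_wpM2l ?powR_ge0// lp_norm_mass// powRVK//.
  apply: le_trans (sum_inj_le_lp_mass M q0 bq si).
  rewrite (sum_ord_cat (fun n => modulus (b (s n)) `^ q) NM) lerDr.
  by rewrite sumr_ge0// => n _; exact: powR_ge0.
apply: le_trans (ler_wpM2l (powR_ge0 _ _) tail) _.
rewrite mulrDr.
have -> : scale_at N `^ q * (2 `^ q * lp_norm q b `^ q) =
    2 `^ q * (scale_at N * lp_norm q b) `^ q.
  by rewrite powRM ?(ltW t0)//; ring.
have -> : scale_at N `^ q * (L * lp_norm 1 a) =
    2 * (k `^ (q - 1) * lp_norm 1 a).
  have -> : k `^ (q - 1) = N%:R `^ (q - 1) * (k / N%:R) `^ (q - 1).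
    rewrite -powRM ?ler0n ?divr_ge0//; congr (_ `^ _).
    by rewrite mulrC divfK// gt_eqF.
  by rewrite /L scale_at_powR; ring.
have kq : k `^ (q - 1) * k = k `^ q by rewrite mulrC mulr_powRB1.
have h1 : k `^ (q - 1) * lp_norm 1 a <= k `^ q.
  by rewrite -kq ler_wpM2l ?powR_ge0// lerDl.
have h2 : (scale_at N * lp_norm q b) `^ q <= k `^ q.
  by rewrite powR_le ?(ltW q0)// lerDr.
have h3 : 2 <= 2 `^ q :> R by rewrite le1r_powR// ler1n.
have -> : (4 * k) `^ q = 2 `^ q * 2 `^ q * k `^ q.
  by rewrite -!powRM ?mulr_ge0//; congr (_ `^ _); ring.
have kq0 := powR_ge0 k q.
apply: le_trans (_ : 2 * k `^ q + 2 `^ q * k `^ q <= _).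
  by rewrite lerD// ler_wpM2l// powR_ge0.
rewrite -mulrDl ler_wpM2r//.
nra.
Qed.

Lemma sum_rearrangement_le_K y N : (0 < N)%N ->
  sum_space (lp_space F (lexx 1)) (lp_space F q1) y ->
  \sum_(n < N) rearrangement y n <= K (scale_at N) y.
Proof.
move=> N0 ys; apply: K_functional_ge => // a b a1 bq yab.
exact: sum_rearrangement_le_split.
Qed.

Lemma tail_mass_le_K y N : (0 < N)%N ->
  sum_space (lp_space F (lexx 1)) (lp_space F q1) y ->
  scale_at N * (lp_mass q y - rearr_mass q y N) `^ q^-1 <= 4 * K (scale_at N) y.
Proof.
move=> N0 ys; have yq := sum_space_lp ys.
have t0 := scale_at_gt0 N0.
have T0 : 0 <= lp_mass q y - rearr_mass q y N.
  by rewrite subr_ge0 rearr_mass_le.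
rewrite -ler_pdivrMl//; apply: K_functional_ge => // a b a1 bq yab.
rewrite ler_pdivrMl//; apply: (powR_le_inv q0).
- by rewrite mulr_ge0 ?powR_ge0 ?(ltW t0).
- by rewrite mulr_ge0// addr_ge0 ?mulr_ge0 ?lp_norm_nneg ?(ltW t0).
rewrite powRM ?powR_ge0 ?(ltW t0)// powRVK//.
exact: tail_mass_le_split.
Qed.

End KFunctional.

(** * From S_q to the K-property *)

Section KSpace.
Context {R : realType} {F : base_field} (q C r : R)
  (E : normed_subspace (scalar_seq R F)).
Hypotheses (q1 : 1 <= q) (C1 : 1 <= C) (r1 : 1 <= r)
  (Eq : ncarrier E `<=` lp_set q) (ES : property_S q C E)
  (EW : property_WFP r E).
Implicit Types (x y : scalar_seq R F).

Let q0 : 0 < q. Proof. exact: lt_le_trans q1. Qed.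

Local Notation K t x := (K_functional t x (lp_space F (lexx 1)) (lp_space F
  q1)).

Lemma modulusZ (c : R) x n : 0 <= c ->
  modulus ((of_real F c *: x) n) = c * modulus (x n).
Proof.
by move=> c0; rewrite /GRing.scale/= modulusM modulus_of_real ger0_norm.
Qed.

Lemma rearrangementZ (c : R) x n : 0 < c -> lp_set q x ->
  rearrangement (of_real F c *: x) n = c * rearrangement x n.
Proof.
move=> c0 xq; have [s sx] := lp_set_sorts q0 xq; have [si noninc xs] := sx.
rewrite (rearrangement_sorts n sx) (@rearrangement_sorts _ _ _ s).
  by rewrite modulusZ// ltW.
split=> // [i j ij|k].
  by rewrite /= /seq_modulus !modulusZ ?(ltW c0)// ler_wpM2l ?(ltW c0)//;
    exact: noninc.
by rewrite /seq_modulus modulusZ ?(ltW c0)// mulf_eq0 gt_eqF//= => /xs.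
Qed.

Lemma rearr_massZ (c : R) x N : 0 < c -> lp_set q x ->
  rearr_mass q (of_real F c *: x) N = c `^ q * rearr_mass q x N.
Proof.
move=> c0 xq; rewrite rearr_mass.unlock mulr_sumr; apply: eq_bigr => n _.
by rewrite rearrangementZ// powRM ?(ltW c0)// rearrangement_ge0.
Qed.

Lemma lp_massZ (c : R) x : 0 < c -> lp_set q x ->
  lp_mass q (of_real F c *: x) = c `^ q * lp_mass q x.
Proof.
move=> c0 xq; rewrite lp_mass.unlock lp_normZ// modulus_of_real.
by rewrite ger0_norm ?(ltW c0)// powRM ?(ltW c0)// lp_norm_nneg.
Qed.

Lemma sorts_id_real_seq (z : nat -> R) : (forall n, 0 <= z n) ->
  {homo z : i j / (i <= j)%N >-> j <= i} ->
  sorts id (seq_modulus (real_seq F z)).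
Proof.
move=> z0 z_noninc; split=> // [i j ij|k _]; last by exists k.
by rewrite /= /seq_modulus !modulus_real_seq !ger0_norm// z_noninc.
Qed.

(* Where the sum of the first [b] entries of [y] exceeds twice that of [x], the
   inequality between the K-functionals is carried by the [l^q]-parts. *)
Lemma tail_mass_le_of_K x y b : lp_set q x ->
  sum_space (lp_space F (lexx 1)) (lp_space F q1) y ->
  (forall t, 0 < t -> K t y <= K t x) -> (0 < b)%N ->
  2 * \sum_(n < b) rearrangement x n < \sum_(n < b) rearrangement y n ->
  rearrangement y b.-1 `^ q + (lp_mass q y - rearr_mass q y b) <=
  16 `^ q * (lp_mass q x - rearr_mass q x b).
Proof.
move=> xq ys Kyx b0 Xb; have yq := sum_space_lp ys.
have [s sx] := lp_set_sorts q0 xq.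
have t0 := scale_at_gt0 q b0; set t := scale_at q b in t0 *.
have Tx0 : 0 <= lp_mass q x - rearr_mass q x b.
  by rewrite subr_ge0 rearr_mass_le.
have Ty0 : 0 <= lp_mass q y - rearr_mass q y b.
  by rewrite subr_ge0 rearr_mass_le.
pose T := (lp_mass q x - rearr_mass q x b) `^ q^-1.
have T0 : 0 <= T by exact: powR_ge0.
have TE : lp_mass q x - rearr_mass q x b = T `^ q by rewrite powRVK.
have KxT := K_functional_le_sorted q1 b t0 xq sx.
have KyY := sum_rearrangement_le_K b0 ys.
have KyT := tail_mass_le_K b0 ys.
have KK := Kyx _ t0.
rewrite -/t -/T in KxT KyY KyT.
have tT0 : 0 <= t * T by rewrite mulr_ge0// ltW.
(* With $X < Y/2$ and $Y \le K(t,y) \le X + tT$, the head $X$ is absorbed on the left, so that $X <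
   tT$. *)
have Y2 : \sum_(n < b) rearrangement y n <= 2 * (t * T) by lra.
have K2 : K t y <= 2 * (t * T) by lra.
have b0' : 0 < b%:R :> R by rewrite ltr0n.
(* The entry [b.-1] is at most the average of the first [b], and [scale_at b <= b]. *)
have yb : rearrangement y b.-1 <= 2 * T.
  rewrite -(ler_pM2l b0').
  apply: (@le_trans _ _ (\sum_(n < b) rearrangement y n)).
    rewrite mulr_natl -[X in _ *+ X](card_ord b) -sumr_const.
    apply: ler_sum => n _; apply: (rearrangement_noninc q0 yq).
    by rewrite -ltnS prednK.
  apply: le_trans Y2 _; rewrite mulrCA.
  by rewrite ler_wpM2r ?mulr_ge0// scale_at_le.
have yT : lp_mass q y - rearr_mass q y b <= (8 * T) `^ q.
  rewrite -(powRVK q0 Ty0) powR_le ?powR_ge0 ?(ltW q0)//.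
  by rewrite -(ler_pM2l t0); lra.
(* Here 8 is the 4 of [tail_mass_le_K] times the 2 of [K2], and $2^q + 8^q \le 2 \cdot 8^q \le
   16^q$. *)
rewrite TE; apply: (@le_trans _ _ ((2 * T) `^ q + (8 * T) `^ q)).
  by rewrite lerD// powR_le ?rearrangement_ge0 ?(ltW q0).
rewrite !powRM// -mulrDl ler_wpM2r ?powR_ge0//.
have -> : 16 `^ q = 2 `^ q * 8 `^ q :> R.
  by rewrite -powRM//; congr (_ `^ _); ring.
have h2 : 2 <= 2 `^ q :> R by rewrite le1r_powR// ler1n.
have h8 : 2 `^ q <= 8 `^ q :> R by rewrite powR_le ?(ltW q0)//; lra.
nra.
Qed.

(** In the constant, [r * (C * 2)] comes from the majorized part [w1], [C * 16] from the tail part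
    [w2], and the outer [C] from the return from the rearrangement of [y] to [y] itself. *)
Lemma K_space_bound x y : ncarrier E x ->
  sum_space (lp_space F (lexx 1)) (lp_space F q1) y ->
  (forall t, 0 < t -> K t y <= K t x) ->
  ncarrier E y /\ nnorm E y <= C * (r * (C * 2) + C * 16) * nnorm E x.
Proof.
move=> Ex ys Kyx; have xq := Eq Ex; have yq := sum_space_lp ys.
pose ry := rearrangement y.
have ry0 n : 0 <= ry n by exact: rearrangement_ge0.
have ry_noninc : {homo ry : i j / (i <= j)%N >-> j <= i}.
  exact: rearrangement_noninc yq.
pose u := of_real F 2 *: x; have Eu : ncarrier E u by exact: ncarrierZ.
pose ru := rearrangement u.
have ru0 n : 0 <= ru n by exact: rearrangement_ge0.
have ru_noninc : {homo ru : i j / (i <= j)%N >-> j <= i}.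
  exact: rearrangement_noninc (Eq Eu).
pose Y N := \sum_(n < N) ry n; pose U N := \sum_(n < N) ru n.
have YS N : Y N.+1 = Y N + ry N by rewrite /Y big_ord_recr.
have US N : U N.+1 = U N + ru N by rewrite /U big_ord_recr.
have UX N : U N = 2 * \sum_(n < N) rearrangement x n.
  rewrite mulr_sumr; apply: eq_bigr => n _.
  by rewrite /ru rearrangementZ.
(* A minimum of two concave sequences is concave, so [a] is nonincreasing. *)
pose m N := Num.min (Y N) (U N); pose a n := m n.+1 - m n.
have mY N : m N <= Y N by rewrite /m ge_min lexx.
have mU N : m N <= U N by rewrite /m ge_min lexx orbT.
have mYU N : m N = Y N \/ m N = U N.
  by rewrite /m; case: leP => _; [left|right].
have a0 n : 0 <= a n.
  rewrite subr_ge0; have := mY n; have := mU n; have := ry0 n; have := ru0 n.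
  by case: (mYU n.+1) => ->; rewrite ?YS ?US; lra.
have aS n : a n.+1 <= a n.
  rewrite /a; have := mY n; have := mU n; have := mY n.+2; have := mU n.+2.
  have := ry_noninc _ _ (leqnSn n); have := ru_noninc _ _ (leqnSn n).
  by case: (mYU n.+1) => ->; rewrite !YS !US; lra.
have a_noninc : {homo a : i j / (i <= j)%N >-> j <= i}.
  exact: (nonincreasing_seqP a).1 aS.
have am N : \sum_(n < N) a n = m N.
  elim: N => [|N IH]; last by rewrite big_ord_recr/= IH /a subrKC.
  by rewrite big_ord0 /m /Y /U !big_ord0 minxx.
(* Where the minimum passes from [U] back to [Y], [a n] may exceed [ry n]; cutting it there keeps
   [w2] nonnegative. *)
pose w1 n := Num.min (a n) (ry n); pose w2 n := ry n - w1 n.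
have w1P n : 0 <= w1 n <= a n.
  by rewrite /w1 le_min a0 ry0 ge_min lexx.
have w2P n : 0 <= w2 n <= ry n.
  rewrite /w2 subr_ge0 /w1 ge_min lexx orbT /= gerBl.
  by case/andP: (w1P n).
have w2_0 n : ~~ (U n < Y n) -> ~~ (U n.+1 < Y n.+1) -> w2 n = 0.
  rewrite -!leNgt => h1 h2; rewrite /w2 /w1.
  by rewrite /a /m (min_l h1) (min_l h2) YS addrAC subrr add0r minxx subrr.
have [E1 n1] : ncarrier E (real_seq F w1) /\
    nnorm E (real_seq F w1) <= r * (C * nnorm E u).
  apply: (property_S_WFP_majorized q1 C1 Eq ES _ EW Eu a_noninc w1P).
    exact: le_trans r1.
  by move=> N; rewrite am.
have w2q : lp_set q (real_seq F w2).
  apply: (@lp_set_bound _ _ _ _ (lp_mass q y)) => // N.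
  apply: le_trans (rearr_mass_le N q0 yq).
  rewrite rearr_mass.unlock; apply: ler_sum => n _.
  have /andP[w20 w2y] := w2P n.
  by rewrite modulus_real_seq ger0_norm// powR_le ?(ltW q0).
pose v := of_real F 16 *: x; have Ev : ncarrier E v by exact: ncarrierZ.
have [E2 n2] : ncarrier E (real_seq F w2) /\
    nnorm E (real_seq F w2) <= C * nnorm E v.
  apply: (property_S_tail q1 C1 Eq ES Ev w2q) => N.
  rewrite lp_massZ// rearr_massZ// -mulrBr.
  have TN0 : 0 <= lp_mass q x - rearr_mass q x N.
    by rewrite subr_ge0 rearr_mass_le.
  apply: tail_mass_le => // M NM.
  have w2E n : modulus (real_seq F w2 n) = w2 n.
    by rewrite modulus_real_seq ger0_norm//; case/andP: (w2P n).
  under eq_bigr do rewrite w2E.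
  have [exb|nob] := pselect (exists b, (N <= b)%N && (U b < Y b)); last first.
    rewrite big_nat big1 ?mulr_ge0 ?powR_ge0// => n /andP[Nn _].
    rewrite w2_0 ?powR0 ?gt_eqF//; apply/negP => UY; apply: nob.
      by exists n; rewrite Nn.
    by exists n.+1; rewrite leqW.
  (* At the first crossing [b] from [N] on, [w2] has no entries between [N] and [b.-1]. The entry
     [b.-1] itself may be nonzero, as its increment ends at [b]; the extra term of
     [tail_mass_le_of_K] pays for it. The tail of [x] beyond [b] is then enlarged to the one beyond
     [N]. *)
  case: (ex_minnP exb) => b /andP[Nb UYb] bmin.
  have b0 : (0 < b)%N.
    by rewrite lt0n; apply/eqP => b0; move: UYb;
      rewrite b0 /U /Y !big_ord0 ltxx.
  have w2_low n : (N <= n)%N -> (n < b.-1)%N -> w2 n = 0.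
    move=> Nn nb; apply: w2_0; apply/negP => UY.
      have := bmin n; rewrite Nn UY => /(_ isT).
      by rewrite leqNgt (leq_trans nb)// leq_pred.
    have := bmin n.+1; rewrite (leqW Nn) UY => /(_ isT).
    by rewrite leqNgt -ltn_predRL nb.
  have key := tail_mass_le_of_K xq ys Kyx b0.
  rewrite -UX -/(ry _) in key; have {}key := key UYb.
  apply: (@le_trans _ _ (16 `^ q * (lp_mass q x - rearr_mass q x b)));
    last first.
    by rewrite ler_wpM2l ?powR_ge0// lerD2l lerN2 rearr_mass_homo.
  apply: le_trans key.
  apply: (@le_trans _ _ (\sum_(N <= n < M)
    (ry b.-1 `^ q * (n == b.-1)%:R + (if (b <= n)%N then ry n `^ q else 0)))).
    rewrite big_nat [leRHS]big_nat; apply: ler_sum => n /andP[Nn _].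
    have w2q' : w2 n `^ q <= ry n `^ q.
      by have /andP[w20 w2y] := w2P n; rewrite powR_le ?(ltW q0).
    have [bn|nb] := leqP b n.
      apply: le_trans w2q' _.
      by rewrite gtn_eqF ?mulr0 ?add0r// prednK.
    rewrite addr0; have [->|nb1] := eqVneq n b.-1.
      rewrite mulr1 powR_le ?(ltW q0)//; by case/andP: (w2P b.-1).
    rewrite mulr0 w2_low ?powR0 ?gt_eqF//.
    by rewrite ltn_neqAle nb1 -ltnS prednK.
  rewrite big_split/= lerD//.
    apply: (@le_trans _ _ (\sum_(n < M) ry b.-1 `^ q * (n == b.-1 :> nat)%:R)).
      rewrite (sum_ord_cat (fun n => ry b.-1 `^ q * (n == b.-1)%:R) NM) lerDr.
      by rewrite sumr_ge0// => n _; rewrite mulr_ge0 ?powR_ge0.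
    have [bM|Mb] := ltnP b.-1 M; first by rewrite sum_indicator.
    rewrite big1 ?powR_ge0// => n _.
    by rewrite ltn_eqF ?mulr0// (leq_trans (ltn_ord n)).
  have [bM|Mb] := leqP b M; last first.
    rewrite big_nat big1 ?subr_ge0 ?rearr_mass_le// => n /andP[_ nM].
    by rewrite leqNgt (ltn_trans nM Mb).
  apply: le_trans (tail_mass_ge q0 yq bM).
  rewrite (@big_cat_nat _ _ _ b N M)//= big_nat big1 ?add0r => [|n /andP[_ nb]].
    by rewrite big_nat [leRHS]big_nat; apply: ler_sum => n /andP[-> _].
  by rewrite leqNgt nb.
have normu : nnorm E u = 2 * nnorm E x.
  by rewrite nnormZ// modulus_of_real ger0_norm.
have normv : nnorm E v = 16 * nnorm E x.
  by rewrite nnormZ// modulus_of_real ger0_norm.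
have wE : real_seq F w1 + real_seq F w2 = real_seq F ry.
  apply/funext => n; rewrite fctE /real_seq -of_realD /w2.
  by rewrite subrKC.
have Ery : ncarrier E (real_seq F ry) by rewrite -wE; exact: ncarrierD.
have nry : nnorm E (real_seq F ry) <= (r * (C * 2) + C * 16) * nnorm E x.
  rewrite -wE; apply: le_trans (nnormD E1 E2) _.
  apply: le_trans (lerD n1 n2) _; rewrite normu normv.
  by rewrite le_eqVlt; apply/orP; left; apply/eqP; ring.
have [] := property_S_rearrangement q1 C1 Eq ES Ery yq.
  move=> n; rewrite (rearrangement_sorts n (sorts_id_real_seq ry0 ry_noninc)).
  by rewrite modulus_real_seq ger0_norm.
move=> Ey ny; split=> //; apply: le_trans ny _.
by rewrite -mulrA ler_wpM2l// (le_trans ler01).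
Qed.

End KSpace.

(** * K-spaces are interpolation spaces *)

Section Interpolation.
Context {R : realType} {F : base_field} {V : lmodType (scalar R F)}.
Implicit Types A : normed_subspace V.

Lemma admissible_K_functional (A0 A1 : normed_subspace V) (T : V -> V) x t : 0
  < t ->
  admissible A0 A1 T -> sum_space A0 A1 x ->
  K_functional t (T x) A0 A1 <= K_functional t x A0 A1.
Proof.
move=> t0 [_ Tlin T0 T1] [a0 [a1 [Aa0 Aa1 xE]]]; apply: lb_le_inf.
  by exists (nnorm A0 a0 + t * nnorm A1 a1), a0, a1.
have sum0 b : ncarrier A0 b -> sum_space A0 A1 b.
  by exists b, 0; split; rewrite ?addr0//; exact: ncarrier0.
have sum1 b : ncarrier A1 b -> sum_space A0 A1 b.
  by exists 0, b; split; rewrite ?add0r//; exact: ncarrier0.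
move=> _ [b0 [b1 [Ab0 Ab1 xE' ->]]].
have [TAb0 Tn0] := T0 _ Ab0; have [TAb1 Tn1] := T1 _ Ab1.
apply: (@le_trans _ _ (nnorm A0 (T b0) + t * nnorm A1 (T b1))).
  apply: ge_inf.
    exists 0 => _ [c0 [c1 [Ac0 Ac1 _ ->]]].
    by rewrite addr_ge0 ?mulr_ge0 ?nnorm_ge0 ?(ltW t0).
  exists (T b0), (T b1); split=> //.
  by rewrite xE' -[b0]scale1r Tlin ?scale1r//; [exact: sum0|exact: sum1].
by rewrite lerD// ler_wpM2l ?(ltW t0).
Qed.

Lemma K_space_interpolation C (A0 A1 : normed_subspace V) A :
  K_space C A0 A1 A -> interpolation_space C A0 A1 A.
Proof.
move=> [A_nontriv A_sub AK]; split=> // T Tadm a Aa.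
have [Tsum _ _ _] := Tadm; have asum := A_sub _ Aa.
apply: (AK a) => //; first exact: Tsum.
by move=> t t0; exact: admissible_K_functional.
Qed.

End Interpolation.

(** * Limits of operators along an ultrafilter *)

Section UltrafilterLimits.
Context {R : realType} (U : set_system nat) {UU : UltraFilter U}.

Lemma ultra_cvg_bounded (f : nat -> R) (B : R) : (forall n, `|f n| <= B) ->
  exists l : R, f @ U --> l.
Proof.
move=> fB; have [|p [_ clp]] := @segment_compact R (- B) B (f @ U) _.
  by apply: nearW => n /=; rewrite in_itv/= -ler_norml.
(* An ultrafilter converges to each of its cluster points. *)
exists p => A pA; have [//|UnA] := in_ultra_setVsetC (f @^-1` A) UU.
by have [z [nAz Az]] := clp (~` A) A UnA pA.
Qed.

Lemma cvg_sum_ord (f : nat -> nat -> R) (l : nat -> R) N :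
  (forall k, f k @ U --> l k) ->
  (fun n => \sum_(k < N) f k n) @ U --> \sum_(k < N) l k.
Proof.
move=> fl; elim: N => [|N IH].
  by under eq_fun do rewrite big_ord0; rewrite big_ord0; exact: cvg_cst.
under eq_fun do rewrite big_ord_recr/=; rewrite big_ord_recr/=.
by apply: cvgD => //; exact: fl.
Qed.

Context {F : base_field}.
Implicit Types (z w : nat -> scalar R F) (c d : scalar R F).

(** Passing to the two parts leaves only the topology of [R] to deal with, for both fields at
    once. *)
Definition scvg z c := (fun n => re_part (z n)) @ U --> re_part c /\
  (fun n => im_part (z n)) @ U --> im_part c.

Lemma scvg_bounded z (B : R) : (forall n, modulus (z n) <= B) ->
  exists c, scvg z c.
Proof.
move=> zB.
have [l lP] := ultra_cvg_bounded (fun n => le_trans (re_part_le (z n)) (zB n)).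
have [m mP] := ultra_cvg_bounded (fun n => le_trans (im_part_le (z n)) (zB n)).
exists (of_parts F l m); split; first by rewrite re_of_parts.
clear lP zB; case: F z mP => [z _|z mP /=]; last by exact: mP.
by rewrite /=; exact: cvg_cst.
Qed.

Lemma scvg_unique z c d : scvg z c -> scvg z d -> c = d.
Proof.
move=> [rc ic] [rd id]; apply: parts_inj.
  exact: (cvg_unique (@Rhausdorff R) rc rd).
exact: (cvg_unique (@Rhausdorff R) ic id).
Qed.

Lemma scvg_linear z w c d a : scvg z c -> scvg w d ->
  scvg (fun n => a * z n + w n) (a * c + d).
Proof.
move=> [rc ic] [rd id]; split.
  rewrite re_partD re_partM; under eq_fun do rewrite re_partD re_partM.
  apply: cvgD rd; apply: cvgB; apply: cvgM => //; exact: cvg_cst.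
rewrite im_partD im_partM; under eq_fun do rewrite im_partD im_partM.
apply: cvgD id; apply: cvgD; apply: cvgM => //; exact: cvg_cst.
Qed.

Lemma scvg_modulus z c : scvg z c ->
  (fun n => modulus (z n)) @ U --> modulus c.
Proof.
move=> [rc ic]; rewrite modulus_parts; under eq_fun do rewrite modulus_parts.
apply: (continuous_cvg _ (@sqrt_continuous R _)).
under eq_fun do rewrite !expr2.
by rewrite !expr2; apply: cvgD; apply: cvgM.
Qed.

Lemma scvg_near z c : \oo `<=` U ->
  (fun n => modulus (z n - c)) @ \oo --> 0 -> scvg z c.
Proof.
move=> ooU /cvgr0_norm_lt zc.
have zcU e : 0 < e -> \forall n \near U, modulus (z n - c) < e.
  move=> e0; apply: ooU; have := zc e e0; apply: filterS => n.
  by rewrite ger0_norm ?modulus_ge0.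
split; apply/cvgrPdist_lt => e /zcU; apply: filterS => n;
  apply: le_lt_trans; rewrite distrC.
  by rewrite -re_partB; exact: re_part_le.
by rewrite -im_partB; exact: im_part_le.
Qed.

End UltrafilterLimits.

Section LimitOperator.
Context {R : realType} {F : base_field} (q : R).
Hypothesis q1 : 1 <= q.
Implicit Types (x y : scalar_seq R F) (T : scalar_seq R F -> scalar_seq R F).

Local Notation l1 := (lp_space F (lexx (1 : R))).
Local Notation lq := (lp_space F q1).

Lemma modulus_le_lp_norm p x k : 1 <= p -> lp_set p x ->
  modulus (x k) <= lp_norm p x.
Proof.
move=> p1 xp; have p0 : 0 < p by exact: lt_le_trans p1.
apply: (powR_le_inv p0) => //; first exact: lp_norm_nneg.
rewrite lp_norm_mass// powRVK//; apply: le_trans (sum_le_lp_mass k.+1 p0 xp).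
by rewrite big_ord_recr/= lerDr sumr_ge0// => i _; exact: powR_ge0.
Qed.

(** A Fatou property: a ball of $\ell^p$ is closed under coordinatewise limits. *)
Lemma ultra_lp_contraction (U : set_system nat) {UU : UltraFilter U} p
    (z : nat -> scalar_seq R F) y (B : R) : 1 <= p -> 0 <= B ->
  (forall n, lp_set p (z n) /\ lp_norm p (z n) <= B) ->
  (forall k, scvg U (fun n => z n k) (y k)) ->
  lp_set p y /\ lp_norm p y <= B.
Proof.
move=> p1 B0 zB zy; have p0 : 0 < p by exact: lt_le_trans p1.
suff yB K : \sum_(k < K) modulus (y k) `^ p <= B `^ p.
  by split; [exact: lp_set_bound yB|exact: lp_norm_le].
(* By convexity the sum is bounded below by an affine function of the moduli,
   to which the limit applies. *)
pose g k n := modulus (y k) `^ p +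
  p * modulus (y k) `^ (p - 1) * (modulus (z n k) - modulus (y k)).
have gy k : g k @ U --> modulus (y k) `^ p.
  rewrite -[X in _ --> X]addr0; apply: cvgD; first exact: cvg_cst.
  rewrite -(mulr0 (p * modulus (y k) `^ (p - 1))).
  apply: cvgM; first exact: cvg_cst.
  rewrite -(subrr (modulus (y k))); apply: cvgB; last exact: cvg_cst.
  exact: scvg_modulus.
apply: (ler_cvg_to (cvg_sum_ord (N := K) gy) (cvg_cst (B `^ p))).
apply: nearW => n; have [zn znB] := zB n.
apply: (@le_trans _ _ (\sum_(k < K) modulus (z n k) `^ p)).
  by apply: ler_sum => k _; exact: powR_tangent.
apply: le_trans (sum_le_lp_mass K p0 zn) _.
by rewrite lp_mass.unlock powR_le ?lp_norm_nneg ?(ltW p0).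
Qed.

(** Contractivity bounds each coordinate of [Tn n a] and [Tn n b] for a splitting [a + b] of [x], so
    the limits exist. Uniqueness of limits makes the chosen values linear and independent of the
    splitting. *)
Lemma exists_limit_operator (U : set_system nat) {UU : UltraFilter U}
    (Tn : nat -> scalar_seq R F -> scalar_seq R F) :
  (forall n (a : scalar R F) x y k,
    Tn n (a *: x + y) k = a * Tn n x k + Tn n y k) ->
  (forall n, contraction_on l1 (Tn n)) -> (forall n, contraction_on lq (Tn n))
    ->
  exists T, admissible l1 lq T /\
    forall x, sum_space l1 lq x -> forall k, scvg U (fun n => Tn n x k) (T x k).
Proof.
move=> Tlin T1 Tq.
have TD n x y k : Tn n (x + y) k = Tn n x k + Tn n y k.
  by rewrite -[x]scale1r Tlin mul1r scale1r.
have lim1 x : lp_set 1 x -> forall k, exists c, scvg U (fun n => Tn n x k) c.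
  move=> x1 k; apply: (scvg_bounded (B := lp_norm 1 x)) => n.
  have [Tx TxB] := T1 n _ x1.
  exact: le_trans (modulus_le_lp_norm _ (lexx 1) Tx) TxB.
have limq x : lp_set q x -> forall k, exists c, scvg U (fun n => Tn n x k) c.
  move=> xq k; apply: (scvg_bounded (B := lp_norm q x)) => n.
  have [Tx TxB] := Tq n _ xq.
  exact: le_trans (modulus_le_lp_norm _ q1 Tx) TxB.
have /choice[T TP] : forall x, exists y : scalar_seq R F,
    sum_space l1 lq x -> forall k, scvg U (fun n => Tn n x k) (y k).
  move=> x; have [[a [b [a1 bq xab]]]|nx] := pselect (sum_space l1 lq x);
    last by exists 0 => /nx.
  have /choice[ya yaP] := lim1 _ a1; have /choice[yb ybP] := limq _ bq.
  exists (fun k => 1 * ya k + yb k) => _ k.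
  have -> : (fun n => Tn n x k) = (fun n => 1 * Tn n a k + Tn n b k).
    by apply/funext => n; rewrite xab TD mul1r.
  exact: scvg_linear (yaP k) (ybP k).
have sum1 x : lp_set 1 x -> sum_space l1 lq x.
  by move=> x1; exists x, 0; split; rewrite ?addr0//; exact: ncarrier0.
have sumq x : lp_set q x -> sum_space l1 lq x.
  by move=> xq; exists 0, x; split; rewrite ?add0r//; exact: ncarrier0.
have sum_lin (a : scalar R F) x y : sum_space l1 lq x -> sum_space l1 lq y ->
    sum_space l1 lq (a *: x + y).
  move=> [x0 [x1 [x01 x1q ->]]] [y0 [y1 [y01 y1q ->]]].
  exists (a *: x0 + y0), (a *: x1 + y1); split.
  - by apply: ncarrierD => //; exact: ncarrierZ.
  - by apply: ncarrierD => //; exact: ncarrierZ.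
  - by rewrite scalerDr addrACA.
have Tlinear (a : scalar R F) x y : sum_space l1 lq x -> sum_space l1 lq y ->
    T (a *: x + y) = a *: T x + T y.
  move=> xs ys; apply/funext => k.
  apply: (scvg_unique (TP _ (sum_lin a _ _ xs ys) k)).
  under eq_fun do rewrite Tlin.
  by apply: scvg_linear; exact: TP.
have cT1 : contraction_on l1 T.
  move=> x x1; apply: (@ultra_lp_contraction U _ 1 (fun n => Tn n x)) => //.
  - exact: lp_norm_nneg.
  - by move=> n; exact: T1.
  - exact: TP (sum1 _ x1).
have cTq : contraction_on lq T.
  move=> x xq; apply: (@ultra_lp_contraction U _ q (fun n => Tn n x)) => //.
  - exact: lp_norm_nneg.
  - by move=> n; exact: Tq.
  - exact: TP (sumq _ xq).
exists T; split=> //; split=> // x [a [b [a1 bq ->]]].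
rewrite -[a]scale1r Tlinear; [|exact: sum1|exact: sumq].
rewrite scale1r; exists (T a), (T b); split=> //.
  by have [] := cT1 _ a1.
by have [] := cTq _ bq.
Qed.

End LimitOperator.

(** * Majorization by substochastic matrices *)

Section Transport.
Context {R : realType}.
Implicit Types (a b : nat -> R).

(** The vectors [z] represented by such a matrix include [b], through the identity; lowering an
    entry scales a row, and a transfer averages two rows, which leaves the column sums unchanged.
    [majorization_ind] asks for just this. *)
Lemma exists_substochastic n a b :
  {homo a : i j / (i <= j)%N >-> j <= i} -> (forall k, 0 <= a k) ->
  (forall k, 0 <= b k) ->
  (forall N, (N <= n)%N -> \sum_(k < N) a k <= \sum_(k < N) b k) ->
  exists D : nat -> nat -> R, [/\ forall i k, 0 <= D i k,
    forall i, (i < n)%N -> \sum_(k < n) D i k <= 1,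
    forall k, \sum_(i < n) D i k <= 1
    & forall i, (i < n)%N -> a i = \sum_(k < n) D i k * b k].
Proof.
move=> a_noninc a0 b0 ab.
pose P (z : nat -> R) := exists D : nat -> nat -> R, [/\ forall i k, 0 <= D i k,
    forall i, (i < n)%N -> \sum_(k < n) D i k <= 1,
    forall k, \sum_(i < n) D i k <= 1
    & forall i, (i < n)%N -> z i = \sum_(k < n) D i k * b k].
suff [D [D0 Dr Dc DE]] : P (fun k => if (k < n)%N then a k else 0).
  exists D; split=> // i i_n; by rewrite -DE// i_n.
apply: (majorization_ind _ _ a_noninc a0 b0 ab).
- move=> z w [D [D0 Dr Dc DE]] wz.
  have z0 i : 0 <= z i by have /andP[] := wz i; exact: le_trans.
  have wz1 i : 0 <= w i / z i <= 1.
    have /andP[w0 wzi] := wz i; rewrite divr_ge0//=.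
    move: (z0 i); rewrite le_eqVlt => /orP[/eqP <-|z0'];
      first by rewrite invr0 mulr0.
    by rewrite ler_pdivrMr// mul1r.
  have wD i k : w i / z i * D i k <= D i k.
    by rewrite ler_piMl//; case/andP: (wz1 i).
  exists (fun i k => w i / z i * D i k); split=> [i k|i i_n|k|i i_n].
  + by rewrite mulr_ge0//; case/andP: (wz1 i).
  + by apply: le_trans (Dr i i_n); exact: ler_sum.
  + by apply: le_trans (Dc k); exact: ler_sum.
  + under eq_bigr do rewrite -mulrA.
    rewrite -mulr_sumr -DE//.
    have [zi|zi] := eqVneq (z i) 0; last by rewrite divfK.
    by have := wz i; rewrite zi => wi; rewrite mulr0; lra.
- move=> z i j s /andP[ij jn] /andP[s0 s1] [D [D0 Dr Dc DE]].
  have i_n := ltn_trans ij jn.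
  pose D' r k := if r == i then (1 - s) * D i k + s * D j k
                 else if r == j then s * D i k + (1 - s) * D j k else D r k.
  have s1' : 0 <= 1 - s by rewrite subr_ge0.
  have ji : (j == i) = false by rewrite gtn_eqF.
  exists D'; split=> [r k|r rn|k|r rn].
  + rewrite /D'; case: eqP => _; first by rewrite addr_ge0// mulr_ge0.
    by case: eqP => _ //; rewrite addr_ge0// mulr_ge0.
  + have := Dr i i_n; have := Dr j jn; rewrite /D'.
    case: (eqVneq r i) => [_|_]; first by rewrite big_split/= -!mulr_sumr; nra.
    case: (eqVneq r j) => [_|_ _ _]; last exact: Dr.
    by rewrite big_split/= -!mulr_sumr; nra.
  + have D'E r : D' r k = D r k - s * (D i k - D j k) * (r == i)%:R
        + s * (D i k - D j k) * (r == j)%:R.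
      rewrite /D'; case: (eqVneq r i) => [->|_].
        by rewrite eq_sym ji /=; ring.
      by case: (eqVneq r j) => [->|_] /=; ring.
    under eq_bigr do rewrite D'E.
    by rewrite big_split sumrB/= !sum_indicator// subrK.
  + rewrite /D'; case: (eqVneq r i) => [_|_].
      rewrite DE// DE// !mulr_sumr -big_split/=.
      by apply: eq_bigr => k _; ring.
    case: (eqVneq r j) => [_|_]; last exact: DE.
    rewrite DE// DE// !mulr_sumr -big_split/=.
    by apply: eq_bigr => k _; ring.
- exists (fun i k => (k == i)%:R); split=> [i k|i i_n|k|i i_n].
  + by rewrite ler0n.
  + by under eq_bigr do rewrite -[_%:R]mul1r; rewrite sum_indicator.
  + have [kn|nk] := ltnP k n.
      by under eq_bigr do rewrite eq_sym -[_%:R]mul1r; rewrite sum_indicator.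
    rewrite big1// => i _; rewrite gtn_eqF//.
    exact: leq_trans (ltn_ord i) nk.
  + rewrite (bigD1 (Ordinal i_n))//= eqxx mul1r big1 ?addr0// => k.
    by rewrite -val_eqE/= => /negbTE ->; rewrite mul0r.
Qed.

End Transport.

(** * An operator mapping u to v *)

Section TransportOperator.
Context {R : realType} {F : base_field}.
Implicit Types (u v x : scalar_seq R F) (D : nat -> nat -> R)
  (su sv : nat -> nat) (p q : R).

(** Dividing by the entries of [u] and multiplying by those of [v], rather than by their moduli,
    takes care of signs and phases. As [sv] need not be onto, it is inverted by a sum with at most
    one term, empty at the indices it misses. *)
Definition transport u v (su sv : nat -> nat) D n x : scalar_seq R F :=
  fun j => \sum_(k < n | sv k == j)
    v j * \sum_(i < n) of_real F (D i k) * (x (su i) / u (su i)).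

Lemma modulus_sum (I : Type) (s : seq I) (f : I -> scalar R F) :
  modulus (\sum_(i <- s) f i) <= \sum_(i <- s) modulus (f i).
Proof.
elim: s => [|i s IH]; first by rewrite !big_nil modulus0.
by rewrite !big_cons (le_trans (le_modulusD _ _))// lerD2l.
Qed.

Lemma transport_linear u v su sv D n (a : scalar R F) x y k :
  transport u v su sv D n (a *: x + y) k =
  a * transport u v su sv D n x k + transport u v su sv D n y k.
Proof.
rewrite /transport [a * _]mulr_sumr -big_split/=; apply: eq_bigr => l _.
rewrite mulrCA -mulrDr [a * _]mulr_sumr -big_split/=; congr (_ * _).
apply: eq_bigr => i _; rewrite fctE [(a *: x) _]/(a * x (su i)).
by rewrite mulrDl mulrDr -mulrA mulrCA.
Qed.

Lemma transportE u v su sv D n x k : injective sv -> (k < n)%N ->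
  transport u v su sv D n x (sv k) =
  v (sv k) * \sum_(i < n) of_real F (D i k) * (x (su i) / u (su i)).
Proof.
move=> svi kn; rewrite /transport (big_pred1 (Ordinal kn))// => l /=.
by rewrite (inj_eq svi).
Qed.

(** The weights stand for $|x|/|u|$ along [su]. Where [u] vanishes the quotient is 0 by convention,
    so that entry of [x] is discarded, which only lowers the right-hand side. *)
Lemma transport_contraction p (p1 : 1 <= p) u v su sv D n :
  injective su -> injective sv -> (forall i k, 0 <= D i k) ->
  (forall w : nat -> R, (forall i, 0 <= w i) ->
    \sum_(k < n) (modulus (v (sv k)) * \sum_(i < n) D i k * w i) `^ p <=
    \sum_(i < n) (modulus (u (su i)) * w i) `^ p) ->
  contraction_on (lp_space F p1) (transport u v su sv D n).
Proof.
move=> sui svi D0 Dw x xp; have p0 := lt_le_trans ltr01 p1.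
pose w i := modulus (x (su i)) / modulus (u (su i)).
have w0 i : 0 <= w i by rewrite divr_ge0 ?modulus_ge0.
pose y := transport u v su sv D n x.
suff yx N : \sum_(j < N) modulus (y j) `^ p <= lp_norm p x `^ p.
  split; first exact: lp_set_bound yx.
  by apply: lp_norm_le => //; exact: lp_norm_nneg.
apply: (@le_trans _ _ (\sum_(k < n) modulus (y (sv k)) `^ p)).
  rewrite -(big_mkord predT (fun j => modulus (y j) `^ p)).
  rewrite -(big_mkord predT (fun k => modulus (y (sv k)) `^ p)).
  rewrite -(big_map sv predT (fun j => modulus (y j) `^ p)).
  apply: (sum_uniq_supp_le (f := fun j => modulus (y j) `^ p)).
  - by move=> j; exact: powR_ge0.
  - exact: iota_uniq.
  - by rewrite map_inj_uniq// iota_uniq.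
  move=> j _; apply: contraTT => jN; rewrite negbK /y /transport big1.
    by rewrite modulus0 powR0// gt_eqF.
  move=> k /eqP kj; exfalso; move/negP: jN; apply.
  by rewrite -kj map_f// mem_index_iota/=.
apply: (@le_trans _ _
    (\sum_(k < n) (modulus (v (sv k)) * \sum_(i < n) D i k * w i) `^ p)).
  apply: ler_sum => k _; rewrite powR_le ?(ltW p0)// /y transportE//.
  rewrite modulusM ler_wpM2l ?modulus_ge0//;
    apply: le_trans (modulus_sum _ _) _.
  apply: ler_sum => i _; rewrite !modulusM modulus_of_real ger0_norm//.
  by rewrite modulusV.
apply: le_trans (Dw w w0) _.
have := sum_inj_le_lp_mass n p0 xp sui; rewrite lp_mass.unlock.
apply: le_trans; apply: ler_sum => i _.
rewrite powR_le ?(ltW p0) ?(mulr_ge0 (modulus_ge0 _) (w0 i))// /w.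
have [->|ui] := eqVneq (modulus (u (su i))) 0;
  first by rewrite mul0r modulus_ge0.
by rewrite mulrC divfK.
Qed.

Variables (q : R) (u v : scalar_seq R F) (su sv : nat -> nat)
  (n : nat) (D : nat -> nat -> R).
Hypotheses (q1 : 1 <= q) (sui : injective su) (svi : injective sv)
  (D0 : forall i k, 0 <= D i k)
  (Dr : forall i, (i < n)%N -> \sum_(k < n) D i k <= 1)
  (Dc : forall k, \sum_(i < n) D i k <= 1)
  (DE : forall i, (i < n)%N -> modulus (u (su i)) `^ q =
    \sum_(k < n) D i k * modulus (v (sv k)) `^ q).

Let q0 : 0 < q. Proof. exact: lt_le_trans q1. Qed.

(** Jensen's inequality in [i], with the column sums as weights; then [DE] sums the matrix against
    $|v|^q$. *)
Lemma transport_lq : contraction_on (lp_space F q1) (transport u v su sv D n).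
Proof.
apply: transport_contraction => // w w0.
apply: (@le_trans _ _ (\sum_(k < n) modulus (v (sv k)) `^ q *
    \sum_(i < n) D i k * w i `^ q)).
  apply: ler_sum => k _.
  rewrite powRM ?modulus_ge0 ?sumr_ge0// => [|i _]; last by rewrite mulr_ge0.
  by rewrite ler_wpM2l ?powR_ge0// powR_sum_le.
under eq_bigr do rewrite mulr_sumr.
rewrite exchange_big/=; apply: ler_sum => i _.
rewrite powRM// DE// mulr_suml le_eqVlt; apply/orP; left; apply/eqP.
by apply: eq_bigr => k _; ring.
Qed.

(** Jensen's inequality in [k], with the row sums as weights, turns [DE] into $\sum_k D_{ik} |v_k|
    \le |u_i|$ along the sortings. *)
Lemma transport_l1 :
  contraction_on (lp_space F (lexx 1)) (transport u v su sv D n).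
Proof.
have Dv i : (i < n)%N ->
    \sum_(k < n) D i k * modulus (v (sv k)) <= modulus (u (su i)).
  move=> i_n; apply: (powR_le_inv q0) => //.
    by apply: sumr_ge0 => k _; rewrite mulr_ge0 ?modulus_ge0.
  by rewrite DE//; apply: powR_sum_le => //; exact: Dr.
apply: transport_contraction => // w w0.
apply: (@le_trans _ _ (\sum_(i < n)
    w i * \sum_(k < n) D i k * modulus (v (sv k)))).
  under [leRHS]eq_bigr do rewrite mulr_sumr.
  rewrite [leRHS]exchange_big/=; apply: ler_sum => k _.
  rewrite powRr1; last first.
    by rewrite mulr_ge0 ?modulus_ge0// sumr_ge0// => i _; rewrite mulr_ge0.
  rewrite mulr_sumr le_eqVlt; apply/orP; left; apply/eqP.
  by apply: eq_bigr => i _; ring.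
apply: ler_sum => i _; rewrite powRr1 ?mulr_ge0 ?modulus_ge0// [leRHS]mulrC.
by rewrite ler_wpM2l// Dv.
Qed.

(** The image of [u] at [sv k] is [c k] times [v (sv k)], where [c k] is the column sum over the
    rows with $u \ne 0$. The defects [1 - c l], weighted by $|v|^q$, add up to the gap between the
    two partial masses; being nonnegative, each is bounded by that gap, which vanishes in the limit
    when the total masses agree. *)
Lemma transport_fixed k : (k < n)%N ->
  modulus (v (sv k)) `^ q *
    modulus (transport u v su sv D n u (sv k) - v (sv k)) <=
  modulus (v (sv k)) * \sum_(l < n)
    (modulus (v (sv l)) `^ q - modulus (u (su l)) `^ q).
Proof.
move=> kn.
pose h i : R := (u (su i) != 0)%:R.
have h01 i : 0 <= h i <= 1 by rewrite /h; case: (_ != _);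
  rewrite /= ?lexx ?ler01.
pose c l := \sum_(i < n) D i l * h i.
have c1 l : c l <= 1.
  apply: le_trans (Dc l); apply: ler_sum => i _.
  by rewrite ler_piMr//; case/andP: (h01 i).
have -> : transport u v su sv D n u (sv k) - v (sv k) =
    - (v (sv k) * of_real F (1 - c k)).
  rewrite transportE// of_realD of_realN of_real1 mulrBr mulr1 opprB.
  congr (_ * _ - _); rewrite /c.
  elim: (index_enum _) => [|i s IH]; first by rewrite !big_nil of_real0.
  rewrite !big_cons of_realD -IH of_realM; congr (_ * _ + _).
  rewrite /h; have [->|ui] := eqVneq (u (su i)) 0.
    by rewrite mul0r of_real0.
  by rewrite divff// of_real1.
rewrite modulusN modulusM modulus_of_real ger0_norm ?subr_ge0//.
rewrite mulrCA ler_wpM2l ?modulus_ge0//.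
have -> : \sum_(l < n) (modulus (v (sv l)) `^ q - modulus (u (su l)) `^ q) =
    \sum_(l < n) modulus (v (sv l)) `^ q * (1 - c l).
  under [RHS]eq_bigr do rewrite mulrBr mulr1.
  rewrite !sumrB; congr (_ - _).
  under [RHS]eq_bigr do rewrite /c mulr_sumr.
  rewrite [RHS]exchange_big/=; apply: eq_bigr => i _.
  have -> : modulus (u (su i)) `^ q = h i * modulus (u (su i)) `^ q.
    rewrite /h; have [->|ui] := eqVneq (u (su i)) 0; last by rewrite mul1r.
    by rewrite modulus0 powR0 ?mulr0// gt_eqF.
  rewrite DE// mulr_sumr; apply: eq_bigr => l _; ring.
rewrite (bigD1 (Ordinal kn))//= lerDl sumr_ge0// => l _.
by rewrite mulr_ge0 ?powR_ge0// subr_ge0.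
Qed.

End TransportOperator.

(** * From interpolation to S_q *)

Section InterpolationPropertyS.
Context {R : realType} {F : base_field} (q : R).
Hypothesis q1 : 1 <= q.
Implicit Types (u v : scalar_seq R F).

Let q0 : 0 < q. Proof. exact: lt_le_trans q1. Qed.

Local Notation l1 := (lp_space F (lexx (1 : R))).
Local Notation lq := (lp_space F q1).

Lemma exists_admissible_map u v : lp_set q u -> lp_set q v ->
  (forall N, rearr_mass q u N <= rearr_mass q v N) ->
  lp_mass q u = lp_mass q v ->
  exists T, admissible l1 lq T /\ T u = v.
Proof.
move=> uq vq uv muv.
have [su su_sorts] := lp_set_sorts q0 uq; have [sui su_noninc _] := su_sorts.
have [sv sv_sorts] := lp_set_sorts q0 vq; have [svi _ vsv] := sv_sorts.
pose a k := modulus (u (su k)) `^ q; pose b k := modulus (v (sv k)) `^ q.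
have a0 k : 0 <= a k by exact: powR_ge0.
have b0 k : 0 <= b k by exact: powR_ge0.
have a_noninc : {homo a : i j / (i <= j)%N >-> j <= i}.
  by move=> i j ij; rewrite powR_le ?(ltW q0)//; exact: su_noninc.
have ab N : \sum_(k < N) a k <= \sum_(k < N) b k.
  by rewrite -(rearr_mass_sorts q N su_sorts) -(rearr_mass_sorts q N sv_sorts).
have /choice[D DP] := fun n =>
  exists_substochastic a_noninc a0 b0 (fun N (_ : (N <= n)%N) => ab N).
pose Tn n := transport u v su sv (D n) n.
have [U [UU ooU]] := @ultraFilterLemma nat \oo _.
have T1 n : contraction_on l1 (Tn n).
  by have [D0 Dr Dc DE] := DP n; apply: (transport_l1 q1).
have Tq n : contraction_on lq (Tn n).
  by have [D0 Dr Dc DE] := DP n; exact: transport_lq.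
have [T [Tadm TP]] := exists_limit_operator
  (fun n => transport_linear u v su sv (D n) n) T1 Tq.
exists T; split=> //; apply/funext => j.
have us : sum_space l1 lq u.
  by exists 0, u; split; rewrite ?add0r//; exact: ncarrier0.
apply: (scvg_unique (TP u us j)).
(* At a zero of [v] all the operators give 0. Any other index is reached by [sv], where the error
   estimate applies. *)
have [vj|vj] := eqVneq (v j) 0.
  have -> : (fun n => Tn n u j) = fun=> v j.
    by apply/funext => n; rewrite /Tn /transport big1// => k _;
      rewrite vj mul0r.
  by split; exact: cvg_cst.
have mvj : modulus (v j) != 0 by apply: contra_neq vj => /modulus0_eq0.
have [k kj] := vsv j mvj.
have bk : 0 < modulus (v j) `^ q by rewrite powR_gt0// lt_def mvj modulus_ge0.
apply: scvg_near => //; apply/cvgr0Pnorm_lt => e e0.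
(* Chosen so that the bound [e'] on the mass gap becomes [e] once the powers of [modulus (v j)] in
   [transport_fixed] are divided out; the half makes the inequality strict. *)
pose e' := e * modulus (v j) `^ q / modulus (v j).
have mvj0 : 0 < modulus (v j) by rewrite lt_def mvj modulus_ge0.
have e'0 : 0 < e' / 2 by rewrite divr_gt0// divr_gt0// mulr_gt0.
have [N uN] := rearr_mass_approx q0 e'0 uq.
exists (maxn N k.+1) => // n /=; rewrite geq_max => /andP[Nn kn].
have [D0 Dr Dc DE] := DP n.
have := transport_fixed q1 svi D0 Dc DE kn; rewrite kj -/(Tn n u).
rewrite sumrB -(rearr_mass_sorts q n su_sorts) -(rearr_mass_sorts q n sv_sorts).
have := rearr_mass_le n q0 vq; rewrite -muv => vn.
have un := rearr_mass_homo q u Nn.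
rewrite ger0_norm ?modulus_ge0// => le.
rewrite -(ltr_pM2l bk); apply: le_lt_trans le _.
have -> : modulus (v j) `^ q * e = modulus (v j) * e'.
  by rewrite /e'; field; exact: mvj.
by rewrite ltr_pM2l//; lra.
Qed.

Lemma interpolation_property_S C (E : normed_subspace (scalar_seq R F)) :
  interpolation_space C l1 lq E -> property_S q C E.
Proof.
move=> [_ _ EC] u v uq vq uv muv Eu.
have uv' N : rearr_mass q u N <= rearr_mass q v N.
  by rewrite rearr_mass.unlock; exact: uv.
have muv' : lp_mass q u = lp_mass q v.
  by apply: EFin_inj; rewrite -!nneseries_rearrangement.
have [T [Tadm <-]] := exists_admissible_map uq vq uv' muv'.
exact: EC.
Qed.

End InterpolationPropertyS.

Lemma property_S_K_space (R : realType) (F : base_field) (q C r : R)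
    (q1 : 1 <= q) (E : normed_subspace (scalar_seq R F)) :
  1 <= C -> 1 <= r -> nontrivial E -> ncarrier E `<=` lp_set q ->
  property_WFP r E -> property_S q C E ->
  K_space (C * (r * (C * 2) + C * 16)) (lp_space F (lexx 1)) (lp_space F q1) E.
Proof.
move=> C1 r1 E_nontriv Eq EW ES; split=> // [x /Eq xq|x y _ ys Kyx Ex].
  by exists 0, x; split; rewrite ?add0r//; exact: ncarrier0.
exact: (K_space_bound C1 r1 Eq ES EW).
Qed.

Theorem theorem3p3 (R : realType) (q : R) (hq : 1 <= q) (r : R) (hr : 1 <= r) :
  [/\ forall (F : base_field) (E : normed_subspace (scalar_seq R F)),
        nontrivial E -> ncarrier E `<=` lp_set q -> property_WFP r E ->
        (exists C : R, 1 <= C /\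
           interpolation_space C (lp_space F (lexx 1)) (lp_space F hq) E) <->
        (exists C' : R, 1 <= C' /\ property_S q C' E),
      forall (F : base_field) (E : normed_subspace (scalar_seq R F)),
        nontrivial E -> ncarrier E `<=` lp_set q -> property_WFP r E ->
        forall C : R, 1 <= C ->
        interpolation_space C (lp_space F (lexx 1)) (lp_space F hq) E ->
        property_S q C E
    & forall C : R, 1 <= C ->
      exists C' : R, 1 <= C' /\
        forall (F : base_field) (E : normed_subspace (scalar_seq R F)),
        nontrivial E -> ncarrier E `<=` lp_set q -> property_WFP r E ->
        property_S q C E ->
        interpolation_space C' (lp_space F (lexx 1)) (lp_space F hq) E /\
        K_space C' (lp_space F (lexx 1)) (lp_space F hq) E ].
Proof.
have SK (C : R) : 1 <= C -> exists C' : R, 1 <= C' /\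
    forall (F : base_field) (E : normed_subspace (scalar_seq R F)),
    nontrivial E -> ncarrier E `<=` lp_set q -> property_WFP r E ->
    property_S q C E ->
    interpolation_space C' (lp_space F (lexx 1)) (lp_space F hq) E /\
    K_space C' (lp_space F (lexx 1)) (lp_space F hq) E.
  move=> C1; exists (C * (r * (C * 2) + C * 16)); split; first by nra.
  move=> F E E_nontriv Eq EW ES.
  have EK := property_S_K_space hq C1 hr E_nontriv Eq EW ES.
  by split=> //; exact: K_space_interpolation.
split; last exact: SK.
  move=> F E E_nontriv Eq EW; split=> [[C [C1 EC]]|[C [C1 ES]]].
    exists C; split; first exact: C1.
    exact: (interpolation_property_S EC).
  have [C' [C'1 SK']] := SK C C1.
  exists C'; split; first exact: C'1.
  by case: (SK' F E E_nontriv Eq EW ES).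
move=> F E _ _ _ C _ EC; exact: (interpolation_property_S EC).
Qed.
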